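(* Let $X$ be a complex Banach space of dimension at least $2$, and let $\mathcal R$ be a property of operators satisfying conditions (a) and (b) below. Let $\mathcal S\subseteq\mathcal B(X)$ be a multiplicative semigroup each of whose members has property $\mathcal R$, and suppose $\operatorname{rank}[S,T]\le1$ for all $S,T\in\mathcal S$. Then $\mathcal S$ is triangularizable.
   Context: $\mathcal B(X)$ is the algebra of bounded linear operators on $X$; subspaces are closed linear subspaces; $[S,T]=ST-TS$. A subspace $\mathcal M$ is invariant under a collection $\mathcal C$ if $T(\mathcal M)\subseteq\mathcal M$ for all $T\in\mathcal C$. A collection $\mathcal C$ is triangularizable if there is a chain of subspaces invariant under $\mathcal C$ that is maximal as a chain of subspaces of $X$. If $\mathcal N\subset\mathcal M$ are invariant subspaces of $\mathcal C$, the quotient of $T\in\mathcal C$ is the operator $\hat T$ on $\mathcal M/\mathcal N$ given by $\hat T(x+\mathcal N)=Tx+\mathcal N$. $\mathcal R$ is a property of operators on complex Banach spaces of dimension at least $2$ such that: (a) $\mathcal R$ is inherited by quotients, i.e. if every operator in a collection $\mathcal C$ has $\mathcal R$, then for any invariant subspaces $\mathcal N\subset\mathcal M$ of $\mathcal C$ with $\dim(\mathcal M/\mathcal N)\ge 2$, every quotient $\hat T$ ($T\in\mathcal C$) on $\mathcal M/\mathcal N$ has $\mathcal R$; (b) every commutative semigroup of operators (on a space of dimension at least 2) all having property $\mathcal R$ has a non-trivial invariant subspace. *)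

(* Defs.v *)
From Stdlib Require Import Reals ClassicalEpsilon.
Open Scope R_scope.

Definition C := (R * R)%type.
Definition C0 : C := (0, 0).
Definition C1 : C := (1, 0).
Definition Cadd (a b : C) : C := (fst a + fst b, snd a + snd b).
Definition Cmul (a b : C) : C :=
  (fst a * fst b - snd a * snd b, fst a * snd b + snd a * fst b).
Definition Copp (a : C) : C := (- fst a, - snd a).
Definition Cnorm (a : C) : R := sqrt (fst a ^ 2 + snd a ^ 2).

Record NSpace := {
  car :> Type;
  vzero : car;
  vadd : car -> car -> car;
  vscal : C -> car -> car;
  vnorm : car -> R }.
Arguments vzero {_}.
Arguments vadd {_} _ _.
Arguments vscal {_} _ _.
Arguments vnorm {_} _.

Definition vsub {V : NSpace} (x y : V) : V := vadd x (vscal (Copp C1) y).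

Definition converges {V : NSpace} (u : nat -> V) (l : V) : Prop :=
  forall eps, 0 < eps -> exists N, forall n, (N <= n)%nat -> vnorm (vsub (u n) l) < eps.

Definition cauchy {V : NSpace} (u : nat -> V) : Prop :=
  forall eps, 0 < eps -> exists N, forall n m, (N <= n)%nat -> (N <= m)%nat ->
    vnorm (vsub (u n) (u m)) < eps.

Record IsCBanach (V : NSpace) : Prop := {
  addC : forall x y : V, vadd x y = vadd y x;
  addA : forall x y z : V, vadd x (vadd y z) = vadd (vadd x y) z;
  add0 : forall x : V, vadd x vzero = x;
  addN : forall x : V, vadd x (vscal (Copp C1) x) = vzero;
  scal1 : forall x : V, vscal C1 x = x;
  scalA : forall (a b : C) (x : V), vscal a (vscal b x) = vscal (Cmul a b) x;
  scalDr : forall (a : C) (x y : V), vscal a (vadd x y) = vadd (vscal a x) (vscal a y);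
  scalDl : forall (a b : C) (x : V), vscal (Cadd a b) x = vadd (vscal a x) (vscal b x);
  norm_eq0 : forall x : V, vnorm x = 0 -> x = vzero;
  normZ : forall (a : C) (x : V), vnorm (vscal a x) = Cnorm a * vnorm x;
  normD : forall x y : V, vnorm (vadd x y) <= vnorm x + vnorm y;
  complete : forall u : nat -> V, cauchy u -> exists l, converges u l }.

Definition dim_ge2 (V : NSpace) : Prop :=
  exists x y : V, forall a b : C,
    vadd (vscal a x) (vscal b y) = vzero -> a = C0 /\ b = C0.

Definition bounded_op (V : NSpace) (T : V -> V) : Prop :=
  (forall x y, T (vadd x y) = vadd (T x) (T y)) /\
  (forall a x, T (vscal a x) = vscal a (T x)) /\
  (exists K, forall x, vnorm (T x) <= K * vnorm x).

Record is_subspace (V : NSpace) (M : V -> Prop) : Prop := {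
  sub0 : M vzero;
  subD : forall x y, M x -> M y -> M (vadd x y);
  subZ : forall a x, M x -> M (vscal a x);
  subCl : forall (u : nat -> V) l, (forall n, M (u n)) -> converges u l -> M l }.

Definition invariant (V : NSpace) (M : V -> Prop) (T : V -> V) : Prop :=
  forall x, M x -> M (T x).

Definition incl {V : Type} (M N : V -> Prop) : Prop := forall x, M x -> N x.

Definition rank_le1 (V : NSpace) (D : V -> V) : Prop :=
  exists v : V, forall x, exists c : C, D x = vscal c v.

Definition commutator {V : NSpace} (S T : V -> V) : V -> V :=
  fun x => vsub (S (T x)) (T (S x)).

Definition triangularizable (V : NSpace) (Cc : (V -> V) -> Prop) : Prop :=
  exists Ch : (V -> Prop) -> Prop,
    (forall M, Ch M -> is_subspace V M /\ forall T, Cc T -> invariant V M T) /\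
    (forall M1 M2, Ch M1 -> Ch M2 -> incl M1 M2 \/ incl M2 M1) /\
    (forall M, is_subspace V M ->
       (forall M', Ch M' -> incl M M' \/ incl M' M) -> Ch M).

Definition coset {V : NSpace} (N : V -> Prop) (x : V) : V -> Prop :=
  fun y => N (vsub y x).

Definition qcar (V : NSpace) (M N : V -> Prop) : Type :=
  { A : V -> Prop | exists x, M x /\ A = coset N x }.

Definition qrep {V : NSpace} {M N : V -> Prop} (A : qcar V M N) : V :=
  proj1_sig (constructive_indefinite_description _ (proj2_sig A)).

Lemma qrep_in {V : NSpace} {M N : V -> Prop} (A : qcar V M N) : M (qrep A).
Proof.
  unfold qrep.
  exact (proj1 (proj2_sig (constructive_indefinite_description _ (proj2_sig A)))).
Qed.

Definition qmk {V : NSpace} (M N : V -> Prop) (x : V) (hx : M x) : qcar V M N :=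
  exist _ (coset N x) (ex_intro _ x (conj hx eq_refl)).

Definition is_glb (E : R -> Prop) (m : R) : Prop :=
  (forall t, E t -> m <= t) /\ (forall m', (forall t, E t -> m' <= t) -> m' <= m).

Definition quotient (V : NSpace) (M N : V -> Prop) (HM : is_subspace V M) : NSpace := {|
  car := qcar V M N;
  vzero := qmk M N vzero (sub0 V M HM);
  vadd := fun A B => qmk M N (vadd (qrep A) (qrep B))
                        (subD V M HM _ _ (qrep_in A) (qrep_in B));
  vscal := fun a A => qmk M N (vscal a (qrep A)) (subZ V M HM a _ (qrep_in A));
  vnorm := fun A => epsilon (inhabits 0)
             (fun r => is_glb (fun t => exists y, proj1_sig A y /\ t = vnorm y) r) |}.

Definition qop (V : NSpace) (M N : V -> Prop) (HM : is_subspace V M)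
  (T : V -> V) (HT : invariant V M T) : quotient V M N HM -> quotient V M N HM :=
  fun A => qmk M N (T (qrep A)) (HT _ (qrep_in A)).

Definition inherited_by_quotients (Rp : forall V : NSpace, (V -> V) -> Prop) : Prop :=
  forall (V : NSpace) (Cc : (V -> V) -> Prop),
    IsCBanach V ->
    (forall T, Cc T -> bounded_op V T /\ Rp V T) ->
    forall (M N : V -> Prop) (HM : is_subspace V M), is_subspace V N -> incl N M ->
    (forall T, Cc T -> invariant V M T /\ invariant V N T) ->
    dim_ge2 (quotient V M N HM) ->
    forall T (HT : invariant V M T), Cc T -> Rp (quotient V M N HM) (qop V M N HM T HT).

Definition comm_semigroup_nontriv_inv (Rp : forall V : NSpace, (V -> V) -> Prop) : Prop :=
  forall (V : NSpace) (Sg : (V -> V) -> Prop),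
    IsCBanach V -> dim_ge2 V ->
    (forall T, Sg T -> bounded_op V T /\ Rp V T) ->
    (forall S T, Sg S -> Sg T -> Sg (fun x => S (T x))) ->
    (forall S T, Sg S -> Sg T -> forall x, S (T x) = T (S x)) ->
    exists L : V -> Prop, is_subspace V L /\
      (exists x, L x /\ x <> vzero) /\ (exists x, ~ L x) /\
      (forall T, Sg T -> invariant V L T).

(* Main.v *)
Require Import Defs.
From Stdlib Require Import Reals ClassicalEpsilon.
From Stdlib Require Import Lra Lia List Classical FunctionalExtensionality
  PropExtensionality ProofIrrelevance.
From Coquelicot Require Complex.
From mathcomp Require classical_sets.
(* Again, because [Reals] shadows [C] and [C1]. *)
Require Import Defs.

(** A commuting semigroup is reducible by hypothesis (b).  Suppose that [S, T] = x (.) f is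
    nonzero.  As [S, T^2], [S^2, T] and [S^2, T^2] have rank at most one, f(x) = 0: all
    commutators of the semigroup are nilpotent, hence of trace zero.  The kernel of the map
    v |-> ([S, T] v, ([S, T] U v)_U), U in the semigroup, is a proper closed invariant
    subspace, and it contains x, so is nonzero, provided that f(U x) = 0 for all U.
    Otherwise let S1, S2, S3 = S, T, U and write [S_i, S_(i+1)] = x_(i+2) (.) f_(i+2),
    indices modulo 3.  By the vanishing of traces, f_i(S_i x_i) is, up to sign, the same
    nonzero number for all i.  Rank at most one for the commutators of S_k with the products of
    S_i and S_j gives, for all i <> j, that S_j x_j is a multiple of x_i or f_i S_i one of f_j.
    This forces a cyclic pattern, and then [S2, S1 S3 S1] has rank two.

    The general case follows by applying this to the quotients M/N at the gaps of a maximal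
    chain of invariant subspaces: these are Banach spaces, and the hypotheses pass to them,
    so the gaps have dimension at most one. *)

(** * Linear combinations in a complex vector space *)

(** [C] and its operations are convertible with the complex numbers of Coquelicot, whose field
    structure and inverse are reused. *)
Lemma C_field : field_theory C0 C1 Cadd Cmul (fun a b => Cadd a (Copp b)) Copp
  (fun a b => Cmul a (Complex.Cinv b)) Complex.Cinv (@eq C).
Proof. exact Complex.C_field_theory. Qed.
Add Field C_field : C_field.

Lemma Cmul_eq0 (a b : C) : Cmul a b = C0 -> a = C0 \/ b = C0.
Proof.
  intro H. destruct (classic (a = C0)) as [Ha|Ha]; [now left|right].
  replace b with (Cmul (Complex.Cinv a) (Cmul a b)) by (field; exact Ha).
  rewrite H. ring.
Qed.

(** Reified linear combinations: an identity between vectors holds as soon as the coefficients of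
    each atom agree on both sides. *)
Inductive vexp :=
| VZero | VAtom (n : nat) | VAdd (e1 e2 : vexp) | VScal (c : C) (e : vexp).

Fixpoint veval {V : NSpace} (env : list V) (e : vexp) : V :=
  match e with
  | VZero => vzero
  | VAtom n => nth n env vzero
  | VAdd e1 e2 => vadd (veval env e1) (veval env e2)
  | VScal c e => vscal c (veval env e)
  end.

Fixpoint vcoef (e : vexp) (n : nat) : C :=
  match e with
  | VZero => C0
  | VAtom m => if Nat.eqb m n then C1 else C0
  | VAdd e1 e2 => Cadd (vcoef e1 n) (vcoef e2 n)
  | VScal c e => Cmul c (vcoef e n)
  end.

(** [k] is the index of the head of [env], so the recursion keeps the absolute indices of the
    atoms. *)
Fixpoint lincomb {V : NSpace} (a : nat -> C) (env : list V) (k : nat) : V :=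
  match env with
  | nil => vzero
  | v :: env' => vadd (vscal (a k) v) (lincomb a env' (S k))
  end.

Fixpoint coef_eq {V : NSpace} (e1 e2 : vexp) (env : list V) (k : nat) : Prop :=
  match env with
  | nil => True
  | _ :: env' => vcoef e1 k = vcoef e2 k /\ coef_eq e1 e2 env' (S k)
  end.

Lemma scal0 (V : NSpace) (HV : IsCBanach V) (x : V) : vscal C0 x = vzero.
Proof.
  rewrite <- (addN V HV x).
  replace C0 with (Cadd C1 (Copp C1)) by ring.
  now rewrite (scalDl V HV), (scal1 V HV).
Qed.

Lemma scal_zero (V : NSpace) (HV : IsCBanach V) (a : C) : vscal a (vzero : V) = vzero.
Proof.
  rewrite <- (scal0 V HV vzero) at 1. rewrite (scalA V HV).
  replace (Cmul a C0) with C0 by ring. now apply scal0.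
Qed.

Lemma add0l (V : NSpace) (HV : IsCBanach V) (x : V) : vadd vzero x = x.
Proof. rewrite (addC V HV). now apply add0. Qed.

Lemma add_ACA (V : NSpace) (HV : IsCBanach V) (x y z t : V) :
  vadd (vadd x y) (vadd z t) = vadd (vadd x z) (vadd y t).
Proof.
  rewrite <- !(addA V HV). f_equal. rewrite !(addA V HV). f_equal.
  now apply addC.
Qed.

Lemma lincomb0 (V : NSpace) (HV : IsCBanach V) (env : list V) k :
  lincomb (fun _ => C0) env k = vzero.
Proof.
  revert k; induction env as [|v env IH]; intro k; simpl; [easy|].
  now rewrite IH, (scal0 V HV), (add0 V HV).
Qed.

Lemma lincombD (V : NSpace) (HV : IsCBanach V) (a b : nat -> C) (env : list V) k :
  lincomb (fun n => Cadd (a n) (b n)) env k = vadd (lincomb a env k) (lincomb b env k).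
Proof.
  revert k; induction env as [|v env IH]; intro k; simpl.
  - now rewrite (add0 V HV).
  - now rewrite IH, (scalDl V HV), (add_ACA V HV).
Qed.

Lemma lincombZ (V : NSpace) (HV : IsCBanach V) c (a : nat -> C) (env : list V) k :
  lincomb (fun n => Cmul c (a n)) env k = vscal c (lincomb a env k).
Proof.
  revert k; induction env as [|v env IH]; intro k; simpl.
  - now rewrite (scal_zero V HV).
  - now rewrite IH, (scalDr V HV), (scalA V HV).
Qed.

Lemma lincomb_atom (V : NSpace) (HV : IsCBanach V) (env : list V) m k :
  lincomb (fun n => if Nat.eqb m n then C1 else C0) env k =
  if Nat.leb k m then nth (m - k) env vzero else vzero.
Proof.
  revert k; induction env as [|v env IH]; intro k; simpl.
  - now destruct (Nat.leb k m), (m - k)%nat.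
  - rewrite IH. destruct (Nat.leb_spec k m) as [Hk|Hk].
    + destruct (Nat.eqb_spec m k) as [->|Hn].
      * rewrite Nat.sub_diag. destruct (Nat.leb_spec (S k) k); [lia|].
        now rewrite (scal1 V HV), (add0 V HV).
      * destruct (Nat.leb_spec (S k) m); [|lia].
        replace (m - k)%nat with (S (m - S k)) by lia.
        now rewrite (scal0 V HV), (add0l V HV).
    + destruct (Nat.eqb_spec m k); [lia|].
      destruct (Nat.leb_spec (S k) m); [lia|].
      now rewrite (scal0 V HV), (add0 V HV).
Qed.

Lemma veval_lincomb (V : NSpace) (HV : IsCBanach V) (env : list V) e :
  veval env e = lincomb (vcoef e) env 0.
Proof.
  induction e as [|m|e1 IH1 e2 IH2|c e IH]; simpl.
  - now rewrite (lincomb0 V HV).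
  - rewrite (lincomb_atom V HV). simpl. now rewrite Nat.sub_0_r.
  - now rewrite (lincombD V HV), IH1, IH2.
  - now rewrite (lincombZ V HV), IH.
Qed.

Lemma veval_eq (V : NSpace) (HV : IsCBanach V) (env : list V) e1 e2 :
  coef_eq e1 e2 env 0 -> veval env e1 = veval env e2.
Proof.
  intro H. rewrite !(veval_lincomb V HV). generalize dependent O.
  induction env as [|v env IH]; simpl; intros k H; [easy|].
  destruct H as [-> H]. now rewrite (IH _ H).
Qed.

Ltac vmem x l :=
  lazymatch l with
  | nil => constr:(false)
  | x :: _ => constr:(true)
  | _ :: ?l' => vmem x l'
  end.
Ltac vatoms e l :=
  lazymatch e with
  | vzero => l
  | vadd ?a ?b => let l' := vatoms a l in vatoms b l'
  | vscal _ ?a => vatoms a l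
  | _ => lazymatch vmem e l with true => l | false => constr:(e :: l) end
  end.
Ltac vindex x l :=
  lazymatch l with
  | x :: _ => constr:(O)
  | _ :: ?l' => let n := vindex x l' in constr:(S n)
  end.
Ltac vreify e l :=
  lazymatch e with
  | vzero => constr:(VZero)
  | vadd ?a ?b => let a' := vreify a l in let b' := vreify b l in constr:(VAdd a' b')
  | vscal ?c ?a => let a' := vreify a l in constr:(VScal c a')
  | _ => let n := vindex e l in constr:(VAtom n)
  end.
(* Reduces an identity between linear combinations to the equality of the
   coefficients of each atom. *)
Ltac vcoefs :=
  unfold vsub;
  lazymatch goal with
  | HV : IsCBanach ?V |- @eq _ ?x ?y =>
    let l0 := constr:(@nil (car V)) in
    let l1 := vatoms x l0 in let l := vatoms y l1 in
    let ex := vreify x l in let ey := vreify y l in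
    change (veval l ex = veval l ey); apply (veval_eq V HV);
    cbv [coef_eq vcoef Nat.eqb]; repeat split
  end.
Ltac vec := vcoefs; ring.

(** Linearity split off from [bounded_op], for the purely algebraic study of commutators. *)
Definition lin_op (V : NSpace) (T : V -> V) : Prop :=
  (forall x y, T (vadd x y) = vadd (T x) (T y)) /\
  (forall a x, T (vscal a x) = vscal a (T x)).

Ltac lin := unfold vsub;
  repeat match goal with
  | H : lin_op ?V ?T |- context [?T (vadd _ _)] => rewrite (proj1 H)
  | H : lin_op ?V ?T |- context [?T (vscal _ _)] => rewrite (proj2 H)
  end.

Lemma scal_eq0 (V : NSpace) (HV : IsCBanach V) (a : C) (x : V) :
  vscal a x = vzero -> a = C0 \/ x = vzero.
Proof.
  intro H. destruct (classic (a = C0)) as [Ha|Ha]; [now left|right].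
  replace x with (vscal (Complex.Cinv a) (vscal a x)) by (vcoefs; field; exact Ha).
  rewrite H. now apply scal_zero.
Qed.

Lemma scal_inj (V : NSpace) (HV : IsCBanach V) (a b : C) (x : V) :
  x <> vzero -> vscal a x = vscal b x -> a = b.
Proof.
  intros Hx H.
  destruct (scal_eq0 V HV (Cadd a (Copp b)) x) as [H0|H0]; [|..|easy].
  - replace (vscal (Cadd a (Copp b)) x)
      with (vsub (vscal a x) (vscal b x)) by vec.
    rewrite H. vec.
  - replace a with (Cadd (Cadd a (Copp b)) b) by ring. rewrite H0. ring.
Qed.

Lemma sub_eq0 (V : NSpace) (HV : IsCBanach V) (x y : V) : vsub x y = vzero -> x = y.
Proof.
  intro H. replace x with (vadd (vsub x y) y) by vec. rewrite H. vec.
Qed.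

Lemma addI (V : NSpace) (HV : IsCBanach V) (x y z : V) : vadd x y = vadd x z -> y = z.
Proof.
  intro H. replace y with (vadd (vscal (Copp C1) x) (vadd x y)) by vec.
  rewrite H. vec.
Qed.

Lemma lin_zero (V : NSpace) (HV : IsCBanach V) T : lin_op V T -> T vzero = vzero.
Proof.
  intro H. rewrite <- (scal0 V HV vzero), (proj2 H). now rewrite !(scal0 V HV).
Qed.

(** The factor may vanish, so this relation and [fmult] need not be symmetric. *)
Definition mult {V : NSpace} (x y : V) : Prop := exists c, x = vscal c y.
Definition fmult {V : NSpace} (f g : V -> C) : Prop := exists c, forall v, f v = Cmul c (g v).

(** If a is not a multiple of b, some v makes the determinant a(v) b(u) - a(u) b(v) nonzero. As D u
    and D v lie on one line, their linear dependence is a relation between x and y, in which y has a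
    nonzero coefficient. *)
Lemma rank_le1_two_tensors (V : NSpace) (HV : IsCBanach V) (D : V -> V)
  (a b : V -> C) (x y : V) :
  rank_le1 V D -> (forall v, D v = vadd (vscal (a v) x) (vscal (b v) y)) ->
  x <> vzero -> (exists u, b u <> C0) -> mult y x \/ fmult a b.
Proof.
  intros [w Hw] HD Hx [u Hu].
  destruct (classic (forall v, Cmul (a v) (b u) = Cmul (a u) (b v))) as [H|H].
  - right. exists (Cmul (a u) (Complex.Cinv (b u))). intro v.
    replace (a v) with (Cmul (Cmul (a v) (b u)) (Complex.Cinv (b u)))
      by (field; exact Hu).
    rewrite H. field; exact Hu.
  - left. apply not_all_ex_not in H. destruct H as [v Hv].
    destruct (Hw u) as [cu Hcu], (Hw v) as [cv Hcv].
    rewrite HD in Hcu, Hcv.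
    (* With D u = cu w and D v = cv w, these are the coefficients of x and y in cv D u - cu D v =
       0. *)
    set (p := Cadd (Cmul cv (a u)) (Copp (Cmul cu (a v)))).
    set (q := Cadd (Cmul cv (b u)) (Copp (Cmul cu (b v)))).
    assert (E : vadd (vscal p x) (vscal q y) = vzero).
    { transitivity (vsub (vscal cv (vadd (vscal (a u) x) (vscal (b u) y)))
                         (vscal cu (vadd (vscal (a v) x) (vscal (b v) y)))).
      - unfold p, q. vec.
      - rewrite Hcu, Hcv. vec. }
    destruct (classic (q = C0)) as [Hq|Hq].
    (* If q = 0 then p = 0 too, and the nonzero determinant forces cu = cv = 0. Then D u = D v = 0,
       and eliminating y shows that a nonzero multiple of x is zero. *)
    + rewrite Hq in E.
      assert (Hp : p = C0).
      { destruct (scal_eq0 V HV p x) as [?|?]; [|easy|easy].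
        rewrite <- E. vec. }
      exfalso. unfold p, q in *.
      assert (K : forall s t, Cadd s (Copp t) = C0 -> s = t).
      { intros s t Hst. replace s with (Cadd (Cadd s (Copp t)) t) by ring.
        rewrite Hst. ring. }
      apply K in Hq, Hp.
      assert (cu_0 : cu = C0).
      { destruct (Cmul_eq0 cu (Cadd (Cmul (a v) (b u)) (Copp (Cmul (a u) (b v))))) as [?|E2]; [|easy|].
        - replace (Cmul cu (Cadd (Cmul (a v) (b u)) (Copp (Cmul (a u) (b v)))))
            with (Cadd (Cmul (Cmul cu (a v)) (b u)) (Copp (Cmul (a u) (Cmul cu (b v))))) by ring.
          rewrite <- Hp, <- Hq. ring.
        - now apply K in E2. }
      assert (cv_0 : cv = C0).
      { destruct (Cmul_eq0 cv (b u)) as [?|?]; [|easy|easy].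
        rewrite Hq, cu_0. ring. }
      subst cu cv. rewrite (scal0 V HV) in Hcu, Hcv.
      destruct (scal_eq0 V HV (Cadd (Cmul (a v) (b u)) (Copp (Cmul (a u) (b v)))) x) as [E2|E2]; [| |easy].
      * transitivity (vsub (vscal (b u) (vadd (vscal (a v) x) (vscal (b v) y)))
                           (vscal (b v) (vadd (vscal (a u) x) (vscal (b u) y)))); [vec|].
        rewrite Hcu, Hcv. vec.
      * now apply K in E2.
    + exists (Cmul (Copp p) (Complex.Cinv q)).
      apply (sub_eq0 V HV).
      transitivity (vscal (Complex.Cinv q) (vadd (vscal p x) (vscal q y))).
      * vcoefs; field; exact Hq.
      * rewrite E. now apply scal_zero.
Qed.

(** * Semigroups with commutators of rank at most one *)

(** [S, T] is the nonzero tensor x (.) f, written additively so as to serve as a rewriting rule.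
    Linearity of f is derived in [rank1_comm_linear]. *)
Definition rank1_comm {V : NSpace} (S T : V -> V) (x : V) (f : V -> C) : Prop :=
  x <> vzero /\ (exists u, f u <> C0) /\
  forall v, S (T v) = vadd (T (S v)) (vscal (f v) x).

Definition rank1_semigroup (V : NSpace) (Sg : (V -> V) -> Prop) : Prop :=
  (forall T, Sg T -> lin_op V T) /\
  (forall S T, Sg S -> Sg T -> Sg (fun x => S (T x))) /\
  (forall S T, Sg S -> Sg T -> rank_le1 V (commutator S T)).

Lemma Copp_neq0 (a : C) : a <> C0 -> Copp a <> C0.
Proof.
  intros Ha H. apply Ha. replace a with (Copp (Copp a)) by ring. rewrite H. ring.
Qed.

Lemma fmult_opp {V : NSpace} (f g : V -> C) :
  fmult (fun v => Copp (f v)) (fun v => Copp (g v)) -> fmult f g.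
Proof.
  intros [c H]. exists c. intro v.
  replace (f v) with (Copp (Copp (f v))) by ring. rewrite H. ring.
Qed.

Lemma fmult_opp_r {V : NSpace} (f g : V -> C) :
  fmult f (fun v => Copp (g v)) -> fmult f g.
Proof. intros [c H]. exists (Copp c). intro v. rewrite H. ring. Qed.

Lemma rank1_comm_sym (V : NSpace) (HV : IsCBanach V) S T (x : V) f :
  rank1_comm S T x f -> rank1_comm T S x (fun v => Copp (f v)).
Proof.
  intros (Hx & [u Hu] & H). split; [easy|split].
  - exists u. now apply Copp_neq0.
  - intro v. rewrite H. vec.
Qed.

Lemma rank1_comm_exists (V : NSpace) (HV : IsCBanach V) Sg S T :
  rank1_semigroup V Sg -> Sg S -> Sg T -> ~ (forall v, S (T v) = T (S v)) ->
  exists (x : V) f, rank1_comm S T x f.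
Proof.
  intros (_ & _ & HR) HS HT Hne.
  destruct (HR S T HS HT) as [w Hw].
  destruct (choice _ Hw) as [f Hf].
  assert (E : forall v, S (T v) = vadd (T (S v)) (vscal (f v) w)).
  { intro v. rewrite <- Hf. unfold commutator. vec. }
  apply not_all_ex_not in Hne. destruct Hne as [u Hu].
  exists w, f. split; [|split; [exists u|easy]].
  - intros ->. apply Hu. rewrite E. rewrite (scal_zero V HV). now apply add0.
  - intro H0. apply Hu. rewrite E, H0. vec.
Qed.

Lemma comm_two_tensors (V : NSpace) (HV : IsCBanach V) Sg A B (a b : V -> C) (x y : V) :
  rank1_semigroup V Sg -> Sg A -> Sg B ->
  (forall v, A (B v) = vadd (B (A v)) (vadd (vscal (a v) x) (vscal (b v) y))) ->
  x <> vzero -> (exists u, b u <> C0) -> mult y x \/ fmult a b.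
Proof.
  intros (_ & _ & HR) HA HB H. apply (rank_le1_two_tensors V HV (commutator A B)).
  - now apply HR.
  - intro v. unfold commutator. rewrite H. vec.
Qed.

(** The map v |-> [S, T] v = f(v) x is linear, and the nonzero vector x can be cancelled. *)
Lemma rank1_comm_linear (V : NSpace) (HV : IsCBanach V) S T (x : V) f :
  lin_op V S -> lin_op V T -> rank1_comm S T x f ->
  (forall u v, f (vadd u v) = Cadd (f u) (f v)) /\
  (forall c u, f (vscal c u) = Cmul c (f u)).
Proof.
  intros LS LT (Hx & _ & H). split.
  - intros u v. apply (scal_inj V HV _ _ x Hx), (addI V HV (T (S (vadd u v)))).
    rewrite <- H. lin. rewrite !H. vec.
  - intros c u. apply (scal_inj V HV _ _ x Hx), (addI V HV (T (S (vscal c u)))).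
    rewrite <- H. lin. rewrite !H. vec.
Qed.

(* [S, T^2] = x (f T) + (T x) f has rank at most one. *)
Lemma rank1_comm_eigen (V : NSpace) (HV : IsCBanach V) Sg S T (x : V) f :
  rank1_semigroup V Sg -> Sg S -> Sg T -> rank1_comm S T x f ->
  mult (T x) x \/ fmult (fun v => f (T v)) f.
Proof.
  intros HSg HS HT (Hx & Hf & H).
  pose proof (proj1 HSg T HT) as LT.
  apply (comm_two_tensors V HV Sg S (fun v => T (T v)) _ _ x (T x)); auto.
  - now apply (proj1 (proj2 HSg)).
  - intro v. rewrite !H. lin. rewrite ?H. lin. vec.
Qed.

(** Here x is an eigenvector of S and f one of the transpose of T, so [S, T^2] is the single tensor
    (m x + T x) (.) f. This keeps [S^2, T^2] down to two tensors. *)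
Lemma rank1_comm_nilpotent_mixed (V : NSpace) (HV : IsCBanach V) Sg S T (x : V) f :
  rank1_semigroup V Sg -> Sg S -> Sg T -> rank1_comm S T x f ->
  mult (S x) x -> fmult (fun v => f (T v)) f ->
  f x = C0 \/ mult (T x) x \/ fmult (fun v => f (S v)) f.
Proof.
  intros HSg HS HT R [l Hl] [m Hm].
  pose proof (proj1 HSg S HS) as LS. pose proof (proj1 HSg T HT) as LT.
  destruct (rank1_comm_linear V HV S T x f LS LT R) as [fD fZ].
  destruct R as (Hx & Hf & H).
  destruct (classic (mult (T x) x)) as [HTx|HTx]; [now right; left|].
  assert (Hy : vadd (vscal m x) (T x) <> vzero).
  { intro E. apply HTx. exists (Copp m). apply (addI V HV (vscal m x)).
    rewrite E. vec. }
  (* [S^2, T^2] = (m x + T x) (f S) + (l m x + S T x) f *)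
  destruct (comm_two_tensors V HV Sg (fun v => S (S v)) (fun v => T (T v))
    (fun v => f (S v)) f (vadd (vscal m x) (T x))
    (vadd (vscal (Cmul l m) x) (S (T x)))) as [[k Hk]|E]; auto.
  - now apply (proj1 (proj2 HSg)).
  - now apply (proj1 (proj2 HSg)).
  - intro v. cbv beta.
    assert (E : forall w, S (T (T w)) =
      vadd (T (T (S w))) (vscal (f w) (vadd (vscal m x) (T x)))).
    { intro w. rewrite !H. lin. rewrite Hm. vec. }
    rewrite E. lin. rewrite E, Hl. vec.
  (* As S T x = l T x + f(x) x, the relation reads (l - k)(m x + T x) + f(x) x = 0: either k = l and
     f(x) = 0, or T x is a multiple of x. *)
  - left. rewrite H, Hl in Hk. rewrite (proj2 LT) in Hk.
    destruct (classic (k = l)) as [->|Hkl].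
    + destruct (scal_eq0 V HV (f x) x) as [?|?]; [|easy|easy].
      apply (addI V HV (vadd (vscal (Cmul l m) x) (vscal l (T x)))).
      transitivity (vscal l (vadd (vscal m x) (T x))); [rewrite <- Hk|]; vec.
    + exfalso. apply HTx.
      assert (Hkl' : Cadd k (Copp l) <> C0).
      { intro E. apply Hkl. replace k with (Cadd (Cadd k (Copp l)) l) by ring.
        rewrite E. ring. }
      exists (Cmul (Cadd (Cadd (Cmul l m) (f x)) (Copp (Cmul k m)))
              (Complex.Cinv (Cadd k (Copp l)))).
      apply (sub_eq0 V HV).
      transitivity (vscal (Complex.Cinv (Cadd k (Copp l)))
        (vsub (vscal k (vadd (vscal m x) (T x)))
              (vadd (vscal (Cmul l m) x) (vadd (vscal l (T x)) (vscal (f x) x))))).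
      * vcoefs; field; exact Hkl'.
      * rewrite <- Hk. vcoefs; field; exact Hkl'.
Qed.

(** [rank1_comm_eigen] applies to S and to T. If x is a common eigenvector, then [S, T] x = f(x) x
    vanishes; dually, if f is a common eigenvector of the transposes, then f [S, T] = f(x) f
    vanishes. The mixed cases either give f(x) = 0 at once or reduce to one of these. *)
Lemma rank1_comm_nilpotent (V : NSpace) (HV : IsCBanach V) Sg S T (x : V) f :
  rank1_semigroup V Sg -> Sg S -> Sg T -> rank1_comm S T x f -> f x = C0.
Proof.
  intros HSg HS HT R.
  pose proof (proj1 HSg S HS) as LS. pose proof (proj1 HSg T HT) as LT.
  pose proof (rank1_comm_sym V HV S T x f R) as R'.
  assert (HX : mult (S x) x -> mult (T x) x -> f x = C0).
  { intros [a Ha] [b Hb]. destruct R as (Hx & _ & H).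
    destruct (scal_eq0 V HV (f x) x) as [?|?]; [|easy|easy].
    apply (addI V HV (T (S x))). rewrite <- H, Ha, Hb. lin. rewrite Ha, Hb. vec. }
  assert (HF : fmult (fun v => f (S v)) f -> fmult (fun v => f (T v)) f -> f x = C0).
  { intros [a Ha] [b Hb].
    destruct (rank1_comm_linear V HV S T x f LS LT R) as [fD fZ].
    destruct R as (Hx & [u Hu] & H).
    destruct (Cmul_eq0 (f u) (f x)) as [?|?]; [|easy|easy].
    pose proof (Ha (T u)) as E. simpl in E. rewrite H, fD, fZ, !Hb, Ha in E.
    transitivity (Cadd (Cadd (Cmul b (Cmul a (f u))) (Cmul (f u) (f x)))
                       (Copp (Cmul b (Cmul a (f u))))); [ring|].
    rewrite E. ring. }
  destruct (rank1_comm_eigen V HV Sg S T x f HSg HS HT R) as [HT'|HT'],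
           (rank1_comm_eigen V HV Sg T S x _ HSg HT HS R') as [HS'|HS']; auto.
  - destruct (rank1_comm_nilpotent_mixed V HV Sg T S x _ HSg HT HS R' HT' HS')
      as [E|[E|E]].
    + replace (f x) with (Copp (Copp (f x))) by ring. rewrite E. ring.
    + auto.
    + apply fmult_opp in E, HS'. auto.
  - destruct (rank1_comm_nilpotent_mixed V HV Sg S T x f HSg HS HT R HS' HT')
      as [E|[E|E]]; auto.
  - apply fmult_opp in HS'. auto.
Qed.

(** Extends [rank1_comm_nilpotent] to tensors that may be zero. *)
Lemma comm_tensor_nilpotent (V : NSpace) (HV : IsCBanach V) Sg A B (x : V) f :
  rank1_semigroup V Sg -> Sg A -> Sg B ->
  (forall c u, f (vscal c u) = Cmul c (f u)) ->
  (forall v, A (B v) = vadd (B (A v)) (vscal (f v) x)) -> f x = C0.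
Proof.
  intros HSg HA HB fZ H.
  destruct (classic (x = vzero)) as [->|Hx].
  { rewrite <- (scal0 V HV vzero), fZ. ring. }
  destruct (classic (exists u, f u <> C0)) as [Hu|Hu].
  - apply (rank1_comm_nilpotent V HV Sg A B x f HSg HA HB). now split.
  - apply NNPP. intro Hfx. apply Hu. now exists x.
Qed.

(* [S, U T] = y (g T) + (U x) f is nilpotent of rank at most one, so it has trace zero. *)
Lemma rank1_comm_trace (V : NSpace) (HV : IsCBanach V) Sg S T U (x y : V) f g :
  rank1_semigroup V Sg -> Sg S -> Sg T -> Sg U ->
  rank1_comm S T x f -> rank1_comm S U y g ->
  Cadd (f (U x)) (g (T y)) = C0.
Proof.
  intros HSg HS HT HU Rf Rg.
  pose proof (proj1 HSg S HS) as LS. pose proof (proj1 HSg T HT) as LT.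
  pose proof (proj1 HSg U HU) as LU.
  destruct (rank1_comm_linear V HV S T x f LS LT Rf) as [fD fZ].
  destruct (rank1_comm_linear V HV S U y g LS LU Rg) as [gD gZ].
  destruct Rf as (Hx & Hf & H), Rg as (Hy & _ & K).
  assert (E : forall v, S (U (T v)) =
    vadd (U (T (S v))) (vadd (vscal (g (T v)) y) (vscal (f v) (U x)))).
  { intro v. rewrite K, H. lin. vec. }
  assert (HUT : Sg (fun v => U (T v))) by now apply (proj1 (proj2 HSg)).
  (* The two tensors merge into one, y (.) (g T + c f) or (c y + U x) (.) f, whose trace is the sum
     in question. *)
  destruct (comm_two_tensors V HV Sg S (fun v => U (T v)) (fun v => g (T v)) f y (U x)
    HSg HS HUT E Hy Hf) as [[c Hc]|[c Hc]].
  - rewrite Hc, fZ.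
    rewrite <- (comm_tensor_nilpotent V HV Sg S (fun v => U (T v)) y
      (fun v => Cadd (g (T v)) (Cmul c (f v))) HSg HS HUT).
    + ring.
    + intros a u. rewrite (proj2 LT), gZ, fZ. ring.
    + intro v. rewrite E, Hc. vec.
  - rewrite Hc.
    rewrite <- (comm_tensor_nilpotent V HV Sg S (fun v => U (T v))
      (vadd (vscal c y) (U x)) f HSg HS HUT).
    + rewrite fD, fZ. ring.
    + exact fZ.
    + intro v. rewrite E, Hc. vec.
Qed.

(** As S commutes with U, the commutator [S, U T] is the single tensor (U x) (.) f, of trace f(U
    x). *)
Lemma rank1_comm_trace_commuting (V : NSpace) (HV : IsCBanach V) Sg S T U (x : V) f :
  rank1_semigroup V Sg -> Sg S -> Sg T -> Sg U ->
  rank1_comm S T x f -> (forall v, S (U v) = U (S v)) -> f (U x) = C0.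
Proof.
  intros HSg HS HT HU Rf K.
  pose proof (proj1 HSg S HS) as LS. pose proof (proj1 HSg T HT) as LT.
  pose proof (proj1 HSg U HU) as LU.
  destruct (rank1_comm_linear V HV S T x f LS LT Rf) as [fD fZ].
  destruct Rf as (Hx & Hf & H).
  apply (comm_tensor_nilpotent V HV Sg S (fun v => U (T v))); auto.
  - now apply (proj1 (proj2 HSg)).
  - intro v. rewrite K, H. lin. vec.
Qed.

(** * Triples of pairwise non-commuting operators *)

Record noncomm_triple (V : NSpace) (Sg : (V -> V) -> Prop) (S1 S2 S3 : V -> V)
    (x1 x2 x3 : V) (f1 f2 f3 : V -> C) : Prop := {
  nt_mem1 : Sg S1; nt_mem2 : Sg S2; nt_mem3 : Sg S3;
  nt_comm1 : rank1_comm S2 S3 x1 f1;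
  nt_comm2 : rank1_comm S3 S1 x2 f2;
  nt_comm3 : rank1_comm S1 S2 x3 f3;
  nt_trace1 : f1 (S1 x1) <> C0;
  nt_trace2 : f2 (S2 x2) <> C0;
  nt_trace3 : f3 (S3 x3) <> C0 }.

(** Together with [noncomm_triple_swap] this gives all permutations of the indices, so the later
    lemmas treat one order only. *)
Lemma noncomm_triple_rot (V : NSpace) Sg S1 S2 S3 (x1 x2 x3 : V) f1 f2 f3 :
  noncomm_triple V Sg S1 S2 S3 x1 x2 x3 f1 f2 f3 ->
  noncomm_triple V Sg S2 S3 S1 x2 x3 x1 f2 f3 f1.
Proof. now intros []. Qed.

Lemma noncomm_triple_swap (V : NSpace) (HV : IsCBanach V) Sg S1 S2 S3 (x1 x2 x3 : V) f1 f2 f3 :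
  noncomm_triple V Sg S1 S2 S3 x1 x2 x3 f1 f2 f3 ->
  noncomm_triple V Sg S2 S1 S3 x2 x1 x3 (fun v => Copp (f2 v)) (fun v => Copp (f1 v))
    (fun v => Copp (f3 v)).
Proof.
  intros []; split; auto using rank1_comm_sym, Copp_neq0.
Qed.

(* [S1, S2 S3] = x3 (f3 S3) - (S2 x2) f2 has rank at most one. *)
Lemma noncomm_triple_alt (V : NSpace) (HV : IsCBanach V) Sg S1 S2 S3 (x1 x2 x3 : V) f1 f2 f3 :
  rank1_semigroup V Sg -> noncomm_triple V Sg S1 S2 S3 x1 x2 x3 f1 f2 f3 ->
  mult (S2 x2) x3 \/ fmult (fun v => f3 (S3 v)) f2.
Proof.
  intros HSg [M1 M2 M3 _ (_ & [u Hu] & H2) (Hx3 & _ & H3) _ _ _].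
  pose proof (proj1 HSg S2 M2) as L2.
  destruct (comm_two_tensors V HV Sg S1 (fun v => S2 (S3 v)) (fun v => f3 (S3 v))
    (fun v => Copp (f2 v)) x3 (S2 x2)) as [?|?]; auto using fmult_opp_r.
  - now apply (proj1 (proj2 HSg)).
  - intro v. rewrite H3, H2. lin. vec.
  - exists u. now apply Copp_neq0.
Qed.

(** f separates the two lines: it vanishes at x but not at y, so they meet only in zero. *)
Lemma mult_excl (V : NSpace) (HV : IsCBanach V) (x y z : V) (f : V -> C) :
  (forall c u, f (vscal c u) = Cmul c (f u)) -> f x = C0 -> f y <> C0 ->
  mult z x -> mult z y -> z = vzero.
Proof.
  intros fZ Hx Hy [a Ha] [b Hb].
  destruct (Cmul_eq0 b (f y)) as [E|E]; [|subst b; rewrite Hb; now apply scal0|easy].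
  rewrite <- fZ, <- Hb, Ha, fZ, Hx. ring.
Qed.

(** Dual of [mult_excl], with evaluation at x as the separating functional. *)
Lemma fmult_excl {V : NSpace} (x : V) (f g h : V -> C) :
  f x = C0 -> g x <> C0 -> fmult h f -> fmult h g -> forall v, h v = C0.
Proof.
  intros Hf Hg [a Ha] [b Hb] v.
  destruct (Cmul_eq0 b (g x)) as [E|E]; [|rewrite Hb, E; ring|easy].
  rewrite <- Hb, Ha, Hf. ring.
Qed.

Lemma noncomm_triple_hom (V : NSpace) (HV : IsCBanach V) Sg S1 S2 S3 (x1 x2 x3 : V) f1 f2 f3 :
  rank1_semigroup V Sg -> noncomm_triple V Sg S1 S2 S3 x1 x2 x3 f1 f2 f3 ->
  forall c u, f1 (vscal c u) = Cmul c (f1 u).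
Proof.
  intros HSg [M1 M2 M3 R1 _ _ _ _ _].
  exact (proj2 (rank1_comm_linear V HV S2 S3 x1 f1 (proj1 HSg _ M2) (proj1 HSg _ M3) R1)).
Qed.

(** Each alternative of [noncomm_triple_alt] makes one of the nonzero numbers f2(S2 x2), f3(S3 x3) a
    multiple of f2(x3). These values later separate the x_i, and likewise the f_i. *)
Lemma noncomm_triple_cross (V : NSpace) (HV : IsCBanach V) Sg S1 S2 S3 (x1 x2 x3 : V) f1 f2 f3 :
  rank1_semigroup V Sg -> noncomm_triple V Sg S1 S2 S3 x1 x2 x3 f1 f2 f3 ->
  f2 x2 = C0 /\ f2 x3 <> C0 /\ f2 x1 <> C0.
Proof.
  intros HSg Ht.
  assert (K : forall S1 S2 S3 (x1 x2 x3 : V) f1 f2 f3,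
    noncomm_triple V Sg S1 S2 S3 x1 x2 x3 f1 f2 f3 -> f2 x3 <> C0).
  { clear - HV HSg. intros S1 S2 S3 x1 x2 x3 f1 f2 f3 Ht E.
    pose proof (noncomm_triple_hom V HV _ _ _ _ _ _ _ _ _ _ HSg
      (noncomm_triple_rot _ _ _ _ _ _ _ _ _ _ _ Ht)) as fZ.
    destruct (noncomm_triple_alt V HV _ _ _ _ _ _ _ _ _ _ HSg Ht) as [[c Hc]|[c Hc]].
    - apply (nt_trace2 _ _ _ _ _ _ _ _ _ _ _ Ht). rewrite Hc, fZ, E. ring.
    - apply (nt_trace3 _ _ _ _ _ _ _ _ _ _ _ Ht). rewrite Hc, E. ring. }
  repeat split.
  - destruct Ht. now apply (rank1_comm_nilpotent V HV Sg S3 S1).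
  - exact (K _ _ _ _ _ _ _ _ _ Ht).
  (* The reversed order 3, 2, 1 of the indices turns f2(x3) into f2(x1), up to sign. *)
  - pose proof (K _ _ _ _ _ _ _ _ _ (noncomm_triple_rot _ _ _ _ _ _ _ _ _ _ _
      (noncomm_triple_rot _ _ _ _ _ _ _ _ _ _ _
        (noncomm_triple_swap V HV _ _ _ _ _ _ _ _ _ _ Ht)))) as E.
    simpl in E. intro E'. apply E. rewrite E'. ring.
Qed.

(* The contradiction: [S2, S1 S3 S1] has rank two. *)
Lemma noncomm_triple_oriented (V : NSpace) (HV : IsCBanach V) Sg S1 S2 S3 (x1 x2 x3 : V) f1 f2 f3 :
  rank1_semigroup V Sg -> noncomm_triple V Sg S1 S2 S3 x1 x2 x3 f1 f2 f3 ->
  mult (S1 x1) x2 -> mult (S3 x3) x1 ->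
  fmult (fun v => f1 (S1 v)) f2 -> fmult (fun v => f3 (S3 v)) f1 -> False.
Proof.
  intros HSg Ht [c1 A1] [c3 A3] [d1 B1] [d3 B3].
  destruct (noncomm_triple_cross V HV _ _ _ _ _ _ _ _ _ _ HSg Ht) as (f22 & f23 & f21).
  destruct (noncomm_triple_cross V HV _ _ _ _ _ _ _ _ _ _ HSg
    (noncomm_triple_rot _ _ _ _ _ _ _ _ _ _ _ Ht)) as (f33 & f31 & f32).
  pose proof (noncomm_triple_hom V HV _ _ _ _ _ _ _ _ _ _ HSg Ht) as f1Z.
  pose proof (noncomm_triple_hom V HV _ _ _ _ _ _ _ _ _ _ HSg
    (noncomm_triple_rot _ _ _ _ _ _ _ _ _ _ _ Ht)) as f2Z.
  pose proof (noncomm_triple_hom V HV _ _ _ _ _ _ _ _ _ _ HSg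
    (noncomm_triple_rot _ _ _ _ _ _ _ _ _ _ _
      (noncomm_triple_rot _ _ _ _ _ _ _ _ _ _ _ Ht))) as f3Z.
  destruct Ht as [M1 M2 M3 (Hx1 & _ & H1) (Hx2 & _ & H2) (Hx3 & _ & H3) t1 t2 t3].
  pose proof (proj1 HSg S1 M1) as L1. pose proof (proj1 HSg S3 M3) as L3.
  assert (c1_0 : c1 <> C0).
  { intros ->. apply t1. rewrite A1, f1Z. ring. }
  assert (c3_0 : c3 <> C0).
  { intros ->. apply t3. rewrite A3, f3Z. ring. }
  assert (d1_0 : d1 <> C0).
  { intros ->. apply t1. rewrite B1. ring. }
  assert (d3_0 : d3 <> C0).
  { intros ->. apply t3. rewrite B3. ring. }
  assert (K : forall a b c, Cmul a b = C0 -> a <> C0 -> b <> C0 -> c).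
  { intros a b c E Ea Eb. now destruct (Cmul_eq0 a b E). }
  (* [S2, S1 S3 S1] = x2 (.) (d1 c1 f2 - c3 c1 f3) - x3 (.) (d3 d1 f2). *)
  destruct (comm_two_tensors V HV Sg S2 (fun v => S1 (S3 (S1 v)))
    (fun v => Cadd (Cmul (Cmul d1 c1) (f2 v)) (Copp (Cmul (Cmul c3 c1) (f3 v))))
    (fun v => Copp (Cmul (Cmul d3 d1) (f2 v))) x2 x3) as [[c E]|[c E]]; auto.
  - apply (proj1 (proj2 HSg) S1 (fun v => S3 (S1 v)) M1).
    now apply (proj1 (proj2 HSg) S3 S1).
  - intro v.
    replace (S2 (S1 (S3 (S1 v)))) with
      (vsub (S1 (S2 (S3 (S1 v)))) (vscal (f3 (S3 (S1 v))) x3)) by (rewrite H3; vec).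
    rewrite H1, B1, B3, B1.
    replace (S2 (S1 v)) with (vsub (S1 (S2 v)) (vscal (f3 v) x3)) by (rewrite H3; vec).
    lin. rewrite A3. lin. rewrite A1. vec.
  - exists x3. apply Copp_neq0. intro E. apply (K _ _ False E); auto.
    intro E'. now apply (K _ _ False E').
  (* x3 is no multiple of x2, as f2 vanishes at x2 only. The functionals are not proportional
     either: at x2 the second one vanishes, while the first is -c3 c1 f3(x2). *)
  - apply f23. rewrite E, f2Z, f22. ring.
  - pose proof (E x2) as E2. simpl in E2. rewrite f22 in E2.
    apply (K (Cmul c3 c1) (f3 x2) False); auto.
    + transitivity (Copp (Cadd (Cmul (Cmul d1 c1) C0) (Copp (Cmul (Cmul c3 c1) (f3 x2)))));
        [ring|rewrite E2; ring].
    + intro E'. now apply (K _ _ False E').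
Qed.

(** Either assumption decides all six alternatives of [noncomm_triple_alt] in turn, since no S_i x_i
    is a multiple of both other x_j and no f_i S_i one of both other f_j. The resulting cyclic
    pattern is refuted by [noncomm_triple_oriented], for the triple or for its swap. *)
Lemma noncomm_triple_orient (V : NSpace) (HV : IsCBanach V) Sg S1 S2 S3 (x1 x2 x3 : V) f1 f2 f3 :
  rank1_semigroup V Sg -> noncomm_triple V Sg S1 S2 S3 x1 x2 x3 f1 f2 f3 ->
  (mult (S1 x1) x2 -> False) /\ (fmult (fun v => f2 (S2 v)) f1 -> False).
Proof.
  intros HSg Ht.
  pose proof (noncomm_triple_rot _ _ _ _ _ _ _ _ _ _ _ Ht) as Ht'.
  pose proof (noncomm_triple_rot _ _ _ _ _ _ _ _ _ _ _ Ht') as Ht''.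
  pose proof (noncomm_triple_swap V HV _ _ _ _ _ _ _ _ _ _ Ht) as Hs.
  pose proof (noncomm_triple_rot _ _ _ _ _ _ _ _ _ _ _ Hs) as Hs'.
  pose proof (noncomm_triple_rot _ _ _ _ _ _ _ _ _ _ _ Hs') as Hs''.
  (* In [Pij], S_j x_j is a multiple of x_i or f_i S_i one of f_j. The hypotheses [Qij] below are
     the same alternatives cleared of signs. *)
  pose proof (noncomm_triple_alt V HV _ _ _ _ _ _ _ _ _ _ HSg Ht) as P32.
  pose proof (noncomm_triple_alt V HV _ _ _ _ _ _ _ _ _ _ HSg Ht') as P13.
  pose proof (noncomm_triple_alt V HV _ _ _ _ _ _ _ _ _ _ HSg Ht'') as P21.
  pose proof (noncomm_triple_alt V HV _ _ _ _ _ _ _ _ _ _ HSg Hs) as P31.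
  pose proof (noncomm_triple_alt V HV _ _ _ _ _ _ _ _ _ _ HSg Hs') as P23.
  pose proof (noncomm_triple_alt V HV _ _ _ _ _ _ _ _ _ _ HSg Hs'') as P12.
  destruct (noncomm_triple_cross V HV _ _ _ _ _ _ _ _ _ _ HSg Ht) as (f22 & f23 & f21).
  destruct (noncomm_triple_cross V HV _ _ _ _ _ _ _ _ _ _ HSg Ht') as (f33 & f31 & f32).
  destruct (noncomm_triple_cross V HV _ _ _ _ _ _ _ _ _ _ HSg Ht'') as (f11 & f12 & f13).
  pose proof (noncomm_triple_hom V HV _ _ _ _ _ _ _ _ _ _ HSg Ht) as f1Z.
  pose proof (noncomm_triple_hom V HV _ _ _ _ _ _ _ _ _ _ HSg Ht') as f2Z.
  pose proof (noncomm_triple_hom V HV _ _ _ _ _ _ _ _ _ _ HSg Ht'') as f3Z.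
  pose proof (nt_trace1 _ _ _ _ _ _ _ _ _ _ _ Ht) as t1.
  pose proof (nt_trace2 _ _ _ _ _ _ _ _ _ _ _ Ht) as t2.
  pose proof (nt_trace3 _ _ _ _ _ _ _ _ _ _ _ Ht) as t3.
  assert (Q31 : mult (S1 x1) x3 \/ fmult (fun v => f3 (S3 v)) f1)
    by (destruct P31; auto using fmult_opp).
  assert (Q23 : mult (S3 x3) x2 \/ fmult (fun v => f2 (S2 v)) f3)
    by (destruct P23; auto using fmult_opp).
  assert (Q12 : mult (S2 x2) x1 \/ fmult (fun v => f1 (S1 v)) f2)
    by (destruct P12; auto using fmult_opp).
  clear P31 P23 P12.
  assert (f0 : forall f : V -> C, (forall c u, f (vscal c u) = Cmul c (f u)) -> f vzero = C0).
  { intros f fZ. rewrite <- (scal0 V HV vzero), fZ. ring. }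
  assert (XA : forall x y z (f : V -> C), (forall c u, f (vscal c u) = Cmul c (f u)) ->
    f x = C0 -> f y <> C0 -> f z <> C0 \/ z <> vzero -> mult z x -> ~ mult z y).
  { intros x y z f fZ Hx Hy Hz Z1 Z2.
    pose proof (mult_excl V HV x y z f fZ Hx Hy Z1 Z2) as ->.
    destruct Hz as [Hz|Hz]; auto. }
  assert (Z : forall (f : V -> C) z, (forall c u, f (vscal c u) = Cmul c (f u)) ->
    f z <> C0 -> z <> vzero).
  { intros f z fZ Hz ->. auto. }
  assert (XB : forall x u (f g h : V -> C), f x = C0 -> g x <> C0 -> h u <> C0 ->
    fmult h f -> ~ fmult h g).
  { intros x u f g h Hf Hg Hh Z1 Z2. apply Hh. exact (fmult_excl x f g h Hf Hg Z1 Z2 u). }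
  assert (E1 : mult (S1 x1) x2 -> ~ mult (S1 x1) x3)
    by (apply (XA _ _ _ f2 f2Z f22 f23); right; exact (Z f1 _ f1Z t1)).
  assert (E2 : mult (S2 x2) x1 -> ~ mult (S2 x2) x3)
    by (apply (XA _ _ _ f1 f1Z f11 f13); right; exact (Z f2 _ f2Z t2)).
  assert (E3 : mult (S3 x3) x1 -> ~ mult (S3 x3) x2)
    by (apply (XA _ _ _ f1 f1Z f11 f12); right; exact (Z f3 _ f3Z t3)).
  assert (F1 : fmult (fun v => f1 (S1 v)) f2 -> ~ fmult (fun v => f1 (S1 v)) f3)
    by exact (XB x2 x1 f2 f3 _ f22 f32 t1).
  assert (F2 : fmult (fun v => f2 (S2 v)) f1 -> ~ fmult (fun v => f2 (S2 v)) f3)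
    by exact (XB x1 x2 f1 f3 _ f11 f31 t2).
  assert (F3 : fmult (fun v => f3 (S3 v)) f1 -> ~ fmult (fun v => f3 (S3 v)) f2)
    by exact (XB x1 x3 f1 f2 _ f11 f21 t3).
  split; intro H.
  - apply (noncomm_triple_oriented V HV _ _ _ _ _ _ _ _ _ _ HSg Ht); tauto.
  - apply (noncomm_triple_oriented V HV _ _ _ _ _ _ _ _ _ _ HSg Hs).
    + tauto.
    + tauto.
    + destruct H as [c H]. exists c. intro v. rewrite H. ring.
    + assert (G : fmult (fun v => f3 (S3 v)) f2) by tauto.
      destruct G as [c G]. exists c. intro v. rewrite G. ring.
Qed.

(** The two cases refuted by [noncomm_triple_orient] exhaust the alternative for i = 2, j = 1. *)
Lemma noncomm_triple_absurd (V : NSpace) (HV : IsCBanach V) Sg S1 S2 S3 (x1 x2 x3 : V) f1 f2 f3 :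
  rank1_semigroup V Sg -> ~ noncomm_triple V Sg S1 S2 S3 x1 x2 x3 f1 f2 f3.
Proof.
  intros HSg Ht.
  destruct (noncomm_triple_orient V HV _ _ _ _ _ _ _ _ _ _ HSg Ht) as [HA HB].
  destruct (noncomm_triple_alt V HV _ _ _ _ _ _ _ _ _ _ HSg
    (noncomm_triple_rot _ _ _ _ _ _ _ _ _ _ _
      (noncomm_triple_rot _ _ _ _ _ _ _ _ _ _ _ Ht))) as [H|H]; auto.
Qed.

(** If U commutes with S or T, [rank1_comm_trace_commuting] applies. Otherwise f(U x), the trace of
    U [S, T], equals those of S [T, U] and T [U, S] by [rank1_comm_trace]; were it nonzero, S, T, U
    would form a [noncomm_triple]. *)
Lemma rank1_comm_trace_zero (V : NSpace) (HV : IsCBanach V) Sg S T U (x : V) f :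
  rank1_semigroup V Sg -> Sg S -> Sg T -> Sg U -> rank1_comm S T x f -> f (U x) = C0.
Proof.
  intros HSg HS HT HU R. apply NNPP. intro Hne.
  destruct (classic (forall v, U (S v) = S (U v))) as [K|K].
  { apply Hne. apply (rank1_comm_trace_commuting V HV Sg S T U); auto. }
  destruct (rank1_comm_exists V HV Sg U S HSg HU HS K) as (y & g & Rg).
  pose proof (rank1_comm_sym V HV S T x f R) as R'.
  destruct (classic (forall v, T (U v) = U (T v))) as [K'|K'].
  { pose proof (rank1_comm_trace_commuting V HV Sg T S U x _ HSg HT HS HU R' K') as E.
    simpl in E. apply (Copp_neq0 _ Hne E). }
  destruct (rank1_comm_exists V HV Sg T U HSg HT HU K') as (z & h & Rh).
  pose proof (rank1_comm_trace V HV Sg S T U x y f _ HSg HS HT HU R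
    (rank1_comm_sym V HV U S y g Rg)) as E1.
  pose proof (rank1_comm_trace V HV Sg T S U x z _ h HSg HT HS HU R' Rh) as E2.
  apply (noncomm_triple_absurd V HV Sg S T U z y x h g f HSg).
  split; auto; intro E.
  - apply (Copp_neq0 _ Hne). rewrite <- E2, E. ring.
  - apply Hne. rewrite <- E1, E. ring.
Qed.

(** * Norms, bounded operators and closed subspaces *)

Lemma norm_zero (V : NSpace) (HV : IsCBanach V) : vnorm (vzero : V) = 0.
Proof.
  rewrite <- (scal0 V HV vzero), (normZ V HV).
  change (Cnorm C0) with (Complex.Cmod (Complex.RtoC 0)). rewrite Complex.Cmod_0. ring.
Qed.

Lemma norm_opp (V : NSpace) (HV : IsCBanach V) (x : V) :
  vnorm (vscal (Copp C1) x) = vnorm x.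
Proof.
  rewrite (normZ V HV).
  change (Cnorm (Copp C1)) with (Complex.Cmod (Complex.Copp (Complex.RtoC 1))).
  rewrite Complex.Cmod_m1. ring.
Qed.

(** From 0 = |x - x| <= 2 |x|, positivity not being among the axioms. *)
Lemma norm_ge0 (V : NSpace) (HV : IsCBanach V) (x : V) : 0 <= vnorm x.
Proof.
  pose proof (normD V HV x (vscal (Copp C1) x)) as H.
  rewrite (addN V HV), (norm_zero V HV), (norm_opp V HV) in H. lra.
Qed.

Lemma norm_sub_sym (V : NSpace) (HV : IsCBanach V) (x y : V) :
  vnorm (vsub x y) = vnorm (vsub y x).
Proof. rewrite <- (norm_opp V HV). f_equal. vec. Qed.

Lemma norm_sub_triangle (V : NSpace) (HV : IsCBanach V) (x y z : V) :
  vnorm (vsub x z) <= vnorm (vsub x y) + vnorm (vsub y z).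
Proof.
  replace (vsub x z) with (vadd (vsub x y) (vsub y z)) by vec. now apply normD.
Qed.

Lemma converges_const (V : NSpace) (HV : IsCBanach V) (x : V) : converges (fun _ => x) x.
Proof.
  intros e He. exists O. intros n _.
  replace (vsub x x) with (vzero : V) by vec. now rewrite (norm_zero V HV).
Qed.

Lemma converges_unique (V : NSpace) (HV : IsCBanach V) (u : nat -> V) x y :
  converges u x -> converges u y -> x = y.
Proof.
  intros Hx Hy. apply (sub_eq0 V HV), (norm_eq0 V HV).
  pose proof (norm_ge0 V HV (vsub x y)) as H0.
  destruct (Rle_lt_or_eq_dec _ _ H0) as [H|H]; [|easy].
  destruct (Hx (vnorm (vsub x y) / 2)) as [N1 H1]; [lra|].
  destruct (Hy (vnorm (vsub x y) / 2)) as [N2 H2]; [lra|].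
  specialize (H1 (N1 + N2)%nat ltac:(lia)). specialize (H2 (N1 + N2)%nat ltac:(lia)).
  pose proof (norm_sub_triangle V HV x (u (N1 + N2)%nat) y) as H3.
  rewrite (norm_sub_sym V HV x (u _)) in H3. lra.
Qed.

Lemma bounded_op_lin_op (V : NSpace) T : bounded_op V T -> lin_op V T.
Proof. intros (H1 & H2 & _). now split. Qed.

(** A strictly positive bound, by which one can divide. *)
Lemma bounded_op_bound (V : NSpace) (HV : IsCBanach V) T : bounded_op V T ->
  exists K, 0 < K /\ forall x, vnorm (T x) <= K * vnorm x.
Proof.
  intros (_ & _ & K & HK). exists (Rmax K 1). split.
  - pose proof (Rmax_r K 1). lra.
  - intro x. eapply Rle_trans; [apply HK|]. apply Rmult_le_compat_r.
    + now apply norm_ge0.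
    + apply Rmax_l.
Qed.

Lemma bounded_op_converges (V : NSpace) (HV : IsCBanach V) T (u : nat -> V) l :
  bounded_op V T -> converges u l -> converges (fun n => T (u n)) (T l).
Proof.
  intros HT Hu e He.
  destruct (bounded_op_bound V HV T HT) as (K & K0 & HK).
  apply bounded_op_lin_op in HT.
  destruct (Hu (e / K)) as [N HN]; [now apply Rdiv_lt_0_compat|].
  exists N. intros n Hn.
  replace (vsub (T (u n)) (T l)) with (T (vsub (u n) l)) by (lin; vec).
  eapply Rle_lt_trans; [apply HK|].
  replace e with (K * (e / K)) by (field; lra).
  apply Rmult_lt_compat_l; auto.
Qed.

Lemma bounded_op_comp (V : NSpace) (HV : IsCBanach V) S T :
  bounded_op V S -> bounded_op V T -> bounded_op V (fun x => S (T x)).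
Proof.
  intros HS HT.
  destruct (bounded_op_bound V HV S HS) as (K & K0 & HK).
  destruct (bounded_op_bound V HV T HT) as (M & M0 & HM).
  apply bounded_op_lin_op in HS, HT.
  split; [|split; [|exists (K * M)]]; intros; lin; auto.
  eapply Rle_trans; [apply HK|]. rewrite Rmult_assoc.
  apply Rmult_le_compat_l; [lra|apply HM].
Qed.

Lemma bounded_op_sub (V : NSpace) (HV : IsCBanach V) S T :
  bounded_op V S -> bounded_op V T -> bounded_op V (fun x => vsub (S x) (T x)).
Proof.
  intros HS HT.
  destruct (bounded_op_bound V HV S HS) as (K & K0 & HK).
  destruct (bounded_op_bound V HV T HT) as (M & M0 & HM).
  apply bounded_op_lin_op in HS, HT.
  split; [|split; [|exists (K + M)]]; intros; lin; try vec.
  eapply Rle_trans; [apply (normD V HV)|]. rewrite (norm_opp V HV).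
  rewrite Rmult_plus_distr_r. apply Rplus_le_compat; auto.
Qed.

Lemma is_subspace_zero (V : NSpace) (HV : IsCBanach V) : is_subspace V (fun x => x = vzero).
Proof.
  split.
  - easy.
  - intros x y -> ->. now apply add0.
  - intros a x ->. now apply scal_zero.
  - intros u l Hu Hl. symmetry. apply (converges_unique V HV u); [|easy].
    replace u with (fun _ : nat => vzero : V).
    + now apply converges_const.
    + apply functional_extensionality. intro n. now rewrite Hu.
Qed.

Lemma is_subspace_preimage (V : NSpace) (HV : IsCBanach V) (M : V -> Prop) T :
  bounded_op V T -> is_subspace V M -> is_subspace V (fun x => M (T x)).
Proof.
  intros HT HM. pose proof (bounded_op_lin_op V T HT) as L. split.
  - rewrite (lin_zero V HV T L). now apply sub0.
  - intros x y Hx Hy. lin. now apply subD.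
  - intros a x Hx. lin. now apply subZ.
  - intros u l Hu Hl. apply (subCl V M HM (fun n => T (u n))); auto.
    now apply bounded_op_converges.
Qed.

Lemma is_subspace_meet (V : NSpace) (F : (V -> Prop) -> Prop) :
  (forall M, F M -> is_subspace V M) -> is_subspace V (fun x => forall M, F M -> M x).
Proof.
  intros HF. split.
  - intros M H. now apply sub0, HF.
  - intros x y Hx Hy M H. exact (subD V M (HF M H) x y (Hx M H) (Hy M H)).
  - intros a x Hx M H. exact (subZ V M (HF M H) a x (Hx M H)).
  - intros u l Hu Hl M H. exact (subCl V M (HF M H) u l (fun n => Hu n M H) Hl).
Qed.

(** * Reducibility of non-commuting semigroups *)

Lemma noncomm_reducible (V : NSpace) (HV : IsCBanach V) Sg S T :
  rank1_semigroup V Sg -> (forall T, Sg T -> bounded_op V T) ->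
  Sg S -> Sg T -> ~ (forall v, S (T v) = T (S v)) ->
  exists L : V -> Prop, is_subspace V L /\
    (exists x, L x /\ x <> vzero) /\ (exists x, ~ L x) /\
    (forall T, Sg T -> invariant V L T).
Proof.
  intros HSg Hb HS HT Hne.
  destruct (rank1_comm_exists V HV Sg S T HSg HS HT Hne) as (x & f & R).
  set (D := fun v => vsub (S (T v)) (T (S v))).
  assert (HD : forall v, D v = vscal (f v) x).
  { intro v. unfold D. rewrite (proj2 (proj2 R)). vec. }
  assert (Db : bounded_op V D)
    by (apply bounded_op_sub; auto; apply bounded_op_comp; auto).
  (* The intersection of the kernels of D and of all D U. The kernel of D is listed apart because
     the semigroup may lack an identity. *)
  exists (fun v => forall M : V -> Prop,
    (M = (fun v => D v = vzero) \/ exists U, Sg U /\ M = (fun v => D (U v) = vzero)) -> M v).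
  split; [|split; [|split]].
  - apply is_subspace_meet. intros M [->|(U & HU & ->)].
    + exact (is_subspace_preimage V HV _ D Db (is_subspace_zero V HV)).
    + apply (is_subspace_preimage V HV (fun x => x = vzero) (fun v => D (U v))).
      * now apply bounded_op_comp; auto.
      * exact (is_subspace_zero V HV).
  - exists x. split; [|exact (proj1 R)]. intros M [->|(U & HU & ->)]; rewrite HD.
    + rewrite (rank1_comm_nilpotent V HV Sg S T x f); auto. now apply scal0.
    + rewrite (rank1_comm_trace_zero V HV Sg S T U x f); auto. now apply scal0.
  - destruct R as (Hx & [u Hu] & _). exists u. intro H.
    specialize (H _ (or_introl eq_refl)). simpl in H. rewrite HD in H.
    destruct (scal_eq0 V HV _ _ H); auto.
  - intros U HU v Hv M [->|(W & HW & ->)].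
    + apply (Hv (fun v => D (U v) = vzero)). right. now exists U.
    + apply (Hv (fun v => D (W (U v)) = vzero)). right. exists (fun v => W (U v)).
      split; auto. now apply (proj1 (proj2 HSg)).
Qed.

(** * Quotients of Banach spaces *)

Lemma is_subspace_sub (V : NSpace) (M : V -> Prop) :
  is_subspace V M -> forall x y, M x -> M y -> M (vsub x y).
Proof. intros HM x y Hx Hy. apply (subD V M HM); auto. now apply (subZ V M HM). Qed.

Lemma qmk_eq (V : NSpace) (HV : IsCBanach V) (M N : V -> Prop) (HN : is_subspace V N)
  x hx y hy : N (vsub x y) -> qmk M N x hx = qmk M N y hy.
Proof.
  intro H. apply subset_eq_compat. apply functional_extensionality. intro z.
  apply propositional_extensionality. unfold coset. split; intro Hz.
  - replace (vsub z y) with (vadd (vsub z x) (vsub x y)) by vec. now apply (subD V N HN).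
  - replace (vsub z x) with (vsub (vsub z y) (vsub x y)) by vec.
    now apply is_subspace_sub.
Qed.

Lemma qmk_inv (V : NSpace) (HV : IsCBanach V) (M N : V -> Prop) (HN : is_subspace V N)
  x hx y hy : qmk M N x hx = qmk M N y hy -> N (vsub x y).
Proof.
  intro H. apply (f_equal (@proj1_sig _ _)) in H. simpl in H.
  change (coset N y x). rewrite <- H. unfold coset.
  replace (vsub x x) with (vzero : V) by vec. now apply sub0.
Qed.

Lemma qmk_qrep (V : NSpace) (M N : V -> Prop) (A : qcar V M N) :
  A = qmk M N (qrep A) (qrep_in A).
Proof.
  destruct A as [B HB]. apply subset_eq_compat. unfold qrep. simpl.
  exact (proj2 (proj2_sig (constructive_indefinite_description _ HB))).
Qed.

Lemma qrep_qmk (V : NSpace) (HV : IsCBanach V) (M N : V -> Prop) (HN : is_subspace V N) x hx :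
  N (vsub (qrep (qmk M N x hx)) x).
Proof. apply (qmk_inv V HV M N HN _ (qrep_in _) _ hx). symmetry. apply qmk_qrep. Qed.

(** [completeness] applied to the reflected set. *)
Lemma glb_exists (E : R -> Prop) (m : R) :
  (exists t, E t) -> (forall t, E t -> m <= t) -> exists r, is_glb E r.
Proof.
  intros [t0 Ht0] Hm.
  destruct (completeness (fun t => E (- t))) as [r [Hr1 Hr2]].
  - exists (- m). intros t Ht. specialize (Hm _ Ht). lra.
  - exists (- t0). now rewrite Ropp_involutive.
  - exists (- r). split.
    + intros t Ht. assert (- t <= r); [|lra].
      apply Hr1. now rewrite Ropp_involutive.
    + intros m' Hm'. specialize (Hr2 (- m')).
      assert (r <= - m'); [|lra]. apply Hr2. intros t Ht. specialize (Hm' _ Ht). lra.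
Qed.

Lemma geometric_cauchy (V : NSpace) (HV : IsCBanach V) (u : nat -> V) :
  (forall n, vnorm (vsub (u (S n)) (u n)) < (/ 2) ^ n) -> cauchy u.
Proof.
  intros Hu.
  assert (P : forall n, 0 < (/ 2) ^ n) by (intro n; apply pow_lt; lra).
  (* The bound is the sum of the steps (1/2)^j for n <= j < n + k. *)
  assert (H : forall n k, vnorm (vsub (u (n + k)%nat) (u n)) <= 2 * (/ 2) ^ n - 2 * (/ 2) ^ (n + k)).
  { intros n k. induction k as [|k IH].
    - rewrite Nat.add_0_r. replace (vsub (u n) (u n)) with (vzero : V) by vec.
      rewrite (norm_zero V HV). lra.
    - rewrite Nat.add_succ_r.
      pose proof (norm_sub_triangle V HV (u (S (n + k))) (u (n + k)%nat) (u n)).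
      specialize (Hu (n + k)%nat). simpl pow. lra. }
  intros e He.
  destruct (pow_lt_1_zero (/ 2) ltac:(rewrite Rabs_right; lra) (e / 4) ltac:(lra)) as [N HN].
  exists N. intros n m Hn Hm.
  specialize (HN N (le_n N)). rewrite (Rabs_right _ (Rgt_ge _ _ (P N))) in HN.
  pose proof (norm_sub_triangle V HV (u n) (u N) (u m)) as T.
  rewrite (norm_sub_sym V HV (u N)) in T.
  pose proof (H N (n - N)%nat) as H1. pose proof (H N (m - N)%nat) as H2.
  replace (N + (n - N))%nat with n in H1 by lia.
  replace (N + (m - N))%nat with m in H2 by lia.
  pose proof (P n). pose proof (P m). lra.
Qed.

Section Quotient.
Context (V : NSpace) (HV : IsCBanach V) (M N : V -> Prop)
  (HM : is_subspace V M) (HN : is_subspace V N) (HNM : incl N M).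

Local Notation Q := (quotient V M N HM).

(** The operations of the quotient act on the representatives chosen by [qrep]. These differ from x
    and y by elements of N, so any representatives will do. *)
Lemma qadd x hx y hy :
  vadd (qmk M N x hx : Q) (qmk M N y hy : Q) = qmk M N (vadd x y) (subD V M HM x y hx hy).
Proof.
  simpl. apply (qmk_eq V HV M N HN).
  replace (vsub (vadd (qrep (qmk M N x hx)) (qrep (qmk M N y hy))) (vadd x y)) with
    (vadd (vsub (qrep (qmk M N x hx)) x) (vsub (qrep (qmk M N y hy)) y)) by vec.
  apply (subD V N HN); auto; now apply qrep_qmk.
Qed.

Lemma qscal a x hx :
  vscal a (qmk M N x hx : Q) = qmk M N (vscal a x) (subZ V M HM a x hx).
Proof.
  simpl. apply (qmk_eq V HV M N HN).
  replace (vsub (vscal a (qrep (qmk M N x hx))) (vscal a x)) with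
    (vscal a (vsub (qrep (qmk M N x hx)) x)) by vec.
  apply (subZ V N HN); auto; now apply qrep_qmk.
Qed.

Lemma qop_qmk T HT x hx : lin_op V T -> invariant V N T ->
  qop V M N HM T HT (qmk M N x hx) = qmk M N (T x) (HT x hx).
Proof.
  intros LT IN. unfold qop. apply (qmk_eq V HV M N HN).
  replace (vsub (T (qrep (qmk M N x hx))) (T x)) with
    (T (vsub (qrep (qmk M N x hx)) x)) by (lin; vec).
  apply IN. now apply qrep_qmk.
Qed.

Lemma qmk_eq0 x hx : (qmk M N x hx : Q) = vzero <-> N x.
Proof.
  assert (E : vsub x vzero = x) by vec.
  split; intro H.
  - rewrite <- E. now apply (qmk_inv V HV M N HN) in H.
  - apply (qmk_eq V HV M N HN). now rewrite E.
Qed.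

(** [epsilon] does select an infimum, as the norms on a coset form a nonempty set bounded below by
    zero. *)
Lemma qnorm_glb (A : Q) :
  is_glb (fun t => exists y, proj1_sig A y /\ t = vnorm y) (vnorm A).
Proof.
  simpl. apply epsilon_spec. apply (glb_exists _ 0).
  - exists (vnorm (qrep A)), (qrep A). split; [|easy].
    rewrite (qmk_qrep V M N A) at 1. simpl. unfold coset.
    replace (vsub (qrep A) (qrep A)) with (vzero : V) by vec. now apply sub0.
  - intros t (y & _ & ->). now apply norm_ge0.
Qed.

Lemma qnorm_le x hx : vnorm (qmk M N x hx : Q) <= vnorm x.
Proof.
  apply (proj1 (qnorm_glb (qmk M N x hx))). exists x. split; [|easy].
  simpl. unfold coset. replace (vsub x x) with (vzero : V) by vec. now apply sub0.
Qed.

Lemma qnorm_ge0 (A : Q) : 0 <= vnorm A.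
Proof.
  apply (proj2 (qnorm_glb A)). intros t (y & _ & ->). now apply norm_ge0.
Qed.

(** Otherwise [vnorm A + eps] would be a lower bound of the norms on the coset. *)
Lemma qnorm_approx (A : Q) eps : 0 < eps ->
  exists x hx, A = qmk M N x hx /\ vnorm x < vnorm A + eps.
Proof.
  intro He. apply NNPP. intro H.
  assert (vnorm A + eps <= vnorm A); [|lra].
  apply (proj2 (qnorm_glb A)). intros t (y & Hy & ->).
  apply Rnot_lt_le. intro Hlt. apply H.
  rewrite (qmk_qrep V M N A) in Hy. simpl in Hy. unfold coset in Hy.
  assert (My : M y).
  { replace y with (vadd (vsub y (qrep A)) (qrep A)) by vec.
    apply (subD V M HM); auto. apply qrep_in. }
  exists y, My. split; [|easy].
  rewrite (qmk_qrep V M N A) at 1. apply (qmk_eq V HV M N HN).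
  replace (vsub (qrep A) y) with (vscal (Copp C1) (vsub y (qrep A))) by vec.
  now apply (subZ V N HN).
Qed.

Lemma qsub x hx y hy :
  vsub (qmk M N x hx : Q) (qmk M N y hy : Q) =
  qmk M N (vsub x y) (is_subspace_sub V M HM x y hx hy).
Proof. unfold vsub at 1. rewrite qscal, qadd. apply f_equal, proof_irrelevance. Qed.

Lemma qnormZ_le a (A : Q) : vnorm (vscal a A) <= Cnorm a * vnorm A.
Proof.
  assert (Ha : 0 <= Cnorm a) by exact (Complex.Cmod_ge_0 a).
  apply le_epsilon. intros e He.
  (* The added 1 keeps the denominator positive when a = 0. *)
  destruct (qnorm_approx A (e / (Cnorm a + 1))) as (x & hx & E & Hx).
  { apply Rdiv_lt_0_compat; lra. }
  rewrite E at 1. rewrite qscal. eapply Rle_trans; [apply qnorm_le|].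
  rewrite (normZ V HV). eapply Rle_trans.
  - apply Rmult_le_compat_l; [easy|]. left. exact Hx.
  - rewrite Rmult_plus_distr_l. apply Rplus_le_compat_l.
    replace e with ((Cnorm a + 1) * (e / (Cnorm a + 1))) at 2 by (field; lra).
    apply Rmult_le_compat_r; [|lra]. left. apply Rdiv_lt_0_compat; lra.
Qed.

(** The reverse inequality is [qnormZ_le] for the inverse of a. *)
Lemma qnormZ a (A : Q) : vnorm (vscal a A) = Cnorm a * vnorm A.
Proof.
  apply Rle_antisym; [apply qnormZ_le|].
  destruct (classic (a = C0)) as [->|Ha].
  - change (Cnorm C0) with (Complex.Cmod (Complex.RtoC 0)). rewrite Complex.Cmod_0.
    rewrite Rmult_0_l. apply qnorm_ge0.
  - assert (E : A = vscal (Complex.Cinv a) (vscal a A)).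
    { rewrite (qmk_qrep V M N A), !qscal. apply (qmk_eq V HV M N HN).
      match goal with |- N ?t => replace t with (vzero : V) end; [now apply sub0|].
      vcoefs; field; exact Ha. }
    pose proof (qnormZ_le (Complex.Cinv a) (vscal a A)) as H. rewrite <- E in H.
    change (Cnorm (Complex.Cinv a)) with (Complex.Cmod (Complex.Cinv a)) in H.
    rewrite Complex.Cmod_inv in H by exact Ha.
    pose proof (proj1 (Complex.Cmod_gt_0 a) Ha) as Ha'.
    change (Cnorm a) with (Complex.Cmod a).
    apply (Rmult_le_compat_l (Complex.Cmod a)) in H; [|lra].
    rewrite <- Rmult_assoc, Rinv_r, Rmult_1_l in H by lra. exact H.
Qed.

Lemma qnormD (A B : Q) : vnorm (vadd A B) <= vnorm A + vnorm B.
Proof.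
  apply le_epsilon. intros e He.
  destruct (qnorm_approx A (e / 2) ltac:(lra)) as (x & hx & EA & Hx).
  destruct (qnorm_approx B (e / 2) ltac:(lra)) as (y & hy & EB & Hy).
  rewrite EA at 1. rewrite EB at 1. rewrite qadd.
  pose proof (qnorm_le _ (subD V M HM x y hx hy)).
  pose proof (normD V HV x y). lra.
Qed.

(** A has representatives of arbitrarily small norm, so [qrep A] is a limit of elements of the
    closed subspace N. *)
Lemma qnorm_eq0 (A : Q) : vnorm A = 0 -> A = vzero.
Proof.
  intro H0. rewrite (qmk_qrep V M N A). apply qmk_eq0.
  assert (K : forall n : nat, exists z, N z /\ vnorm (vsub z (qrep A)) < / INR (S n)).
  { intro n. assert (Hn : 0 < / INR (S n)) by (apply Rinv_0_lt_compat, lt_0_INR; lia).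
    destruct (qnorm_approx A _ Hn) as (x & hx & E & Hx).
    exists (vsub (qrep A) x). split.
    - apply (qmk_inv V HV M N HN _ (qrep_in A) _ hx). now rewrite <- qmk_qrep.
    - replace (vsub (vsub (qrep A) x) (qrep A)) with (vscal (Copp C1) x) by vec.
      rewrite (norm_opp V HV). lra. }
  apply choice in K. destruct K as [u Hu].
  apply (subCl V N HN u); [apply Hu|].
  intros e He. destruct (archimed_cor1 e He) as (n0 & Hn0 & Hpos).
  exists n0. intros n Hn. eapply Rlt_trans; [apply Hu|].
  eapply Rle_lt_trans; [|exact Hn0]. apply Rinv_le_contravar.
  - now apply lt_0_INR.
  - apply le_INR. lia.
Qed.

Lemma qmk_converges (u : nat -> V) (hu : forall n, M (u n)) l (hl : M l) :
  converges u l -> converges (fun n => qmk M N (u n) (hu n) : Q) (qmk M N l hl).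
Proof.
  intros Hu e He. destruct (Hu e He) as [n0 Hn0]. exists n0. intros n Hn.
  rewrite qsub. eapply Rle_lt_trans; [apply qnorm_le|]. now apply Hn0.
Qed.

Lemma qsub_triangle (A B D : Q) : vnorm (vsub A D) <= vnorm (vsub A B) + vnorm (vsub B D).
Proof.
  replace (vsub A D) with (vadd (vsub A B) (vsub B D)); [apply qnormD|].
  rewrite (qmk_qrep V M N A), (qmk_qrep V M N B), (qmk_qrep V M N D).
  rewrite !qsub, qadd. apply (qmk_eq V HV M N HN).
  match goal with |- N ?t => replace t with (vzero : V) by vec end. now apply sub0.
Qed.

(* A Cauchy sequence has a subsequence with geometrically decreasing steps, which
   lifts to a sequence of [V] with geometrically decreasing steps. *)
Lemma qcomplete (u : nat -> Q) : cauchy u -> exists l, converges u l.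
Proof.
  intro Hc.
  assert (P : forall n, 0 < (/ 2) ^ n) by (intro n; apply pow_lt; lra).
  destruct (choice _ (fun k => Hc ((/ 2) ^ k) (P k))) as [n0 Hn0].
  (* [p k] is the maximum of n0 0, ..., n0 k, hence nondecreasing and past each threshold. *)
  pose (p := fix p k := match k with O => n0 O | S k => Nat.max (p k) (n0 (S k)) end).
  assert (Hp0 : forall k, (n0 k <= p k)%nat) by (intros [|k]; simpl; lia).
  assert (Hp1 : forall k, (p k <= p (S k))%nat) by (intro k; simpl; lia).
  (* The lifting equation is a premise inside the existential, so that [choice] yields a function
     defined on all pairs. *)
  assert (Hstep : forall k (x : { x | M x }), exists y : { y | M y },
    u (p k) = qmk M N (proj1_sig x) (proj2_sig x) ->
    u (p (S k)) = qmk M N (proj1_sig y) (proj2_sig y) /\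
    vnorm (vsub (proj1_sig y) (proj1_sig x)) < (/ 2) ^ k).
  { intros k [x hx]. simpl proj1_sig. simpl proj2_sig.
    pose proof (Hn0 k (p (S k)) (p k) ltac:(specialize (Hp0 k); specialize (Hp1 k); lia) (Hp0 k)) as H.
    destruct (qnorm_approx (vsub (u (p (S k))) (u (p k)))
      ((/ 2) ^ k - vnorm (vsub (u (p (S k))) (u (p k)))) ltac:(lra)) as (d & hd & Ed & Hd).
    exists (exist _ (vadd d x) (subD V M HM d x hd hx)). simpl proj1_sig. simpl proj2_sig.
    intro Ex. split.
    - rewrite Ex in Ed. rewrite (qmk_qrep V M N (u (p (S k)))) in Ed |- *.
      rewrite qsub in Ed. apply (qmk_inv V HV M N HN) in Ed.
      apply (qmk_eq V HV M N HN).
      replace (vsub (qrep (u (p (S k)))) (vadd d x)) with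
        (vsub (vsub (qrep (u (p (S k)))) x) d) by vec. exact Ed.
    - replace (vsub (vadd d x) x) with d by vec. lra. }
  destruct (choice (fun (kx : nat * {x | M x}) (y : {y | M y}) =>
    u (p (fst kx)) = qmk M N (proj1_sig (snd kx)) (proj2_sig (snd kx)) ->
    u (p (S (fst kx))) = qmk M N (proj1_sig y) (proj2_sig y) /\
    vnorm (vsub (proj1_sig y) (proj1_sig (snd kx))) < (/ 2) ^ fst kx)
    (fun kx => Hstep (fst kx) (snd kx))) as [next Hnext].
  pose (w := fix w k : {x | M x} := match k with
    | O => exist _ (qrep (u (p O))) (qrep_in (u (p O))) | S k => next (k, w k) end).
  assert (Hw : forall k, u (p k) = qmk M N (proj1_sig (w k)) (proj2_sig (w k))).
  { induction k as [|k IH]; [apply qmk_qrep|]. exact (proj1 (Hnext (k, w k) IH)). }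
  assert (Hwc : cauchy (fun k => proj1_sig (w k))).
  { apply (geometric_cauchy V HV). intro k. exact (proj2 (Hnext (k, w k) (Hw k))). }
  destruct (complete V HV _ Hwc) as [l Hl].
  assert (hl : M l) by exact (subCl V M HM _ l (fun k => proj2_sig (w k)) Hl).
  exists (qmk M N l hl). intros e He.
  destruct (qmk_converges _ (fun k => proj2_sig (w k)) l hl Hl (e / 2) ltac:(lra)) as [k1 Hk1].
  destruct (pow_lt_1_zero (/ 2) ltac:(rewrite Rabs_right; lra) (e / 2) ltac:(lra)) as [k2 Hk2].
  (* Past k1, u (p k) is within e/2 of the limit; past k2, the Cauchy bound (1/2)^k is below e/2. *)
  pose (k := (k1 + k2)%nat).
  specialize (Hk1 k ltac:(lia)). specialize (Hk2 k ltac:(lia)).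
  rewrite (Rabs_right _ (Rgt_ge _ _ (P k))) in Hk2.
  exists (n0 k). intros n Hn.
  eapply Rle_lt_trans; [apply (qsub_triangle _ (u (p k)))|].
  pose proof (Hn0 k n (p k) Hn (Hp0 k)). rewrite <- Hw in Hk1. lra.
Qed.

Ltac qvec :=
  repeat match goal with A : car Q |- _ =>
    rewrite (qmk_qrep V M N A); generalize (qrep A) (qrep_in A); clear A; intros
  end;
  repeat rewrite ?qscal, ?qadd; apply (qmk_eq V HV M N HN);
  match goal with |- N ?t => replace t with (vzero : V) by vec end; now apply sub0.

Lemma quotient_banach : IsCBanach Q.
Proof.
  split.
  - intros A B. qvec.
  - intros A B D. qvec.
  - intro A. change (@vzero Q) with (qmk M N vzero (sub0 V M HM) : Q). qvec.
  - intro A. change (@vzero Q) with (qmk M N vzero (sub0 V M HM) : Q). qvec.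
  - intro A. qvec.
  - intros a b A. qvec.
  - intros a A B. qvec.
  - intros a b A. qvec.
  - exact qnorm_eq0.
  - exact qnormZ.
  - exact qnormD.
  - exact qcomplete.
Qed.

Lemma qop_bounded T HT : bounded_op V T -> invariant V N T ->
  bounded_op Q (qop V M N HM T HT).
Proof.
  intros HTb IN. pose proof (bounded_op_lin_op V T HTb) as L.
  destruct (bounded_op_bound V HV T HTb) as (K & K0 & HK).
  split; [|split].
  - intros A B. rewrite (qmk_qrep V M N A), (qmk_qrep V M N B), qadd, !qop_qmk, qadd; auto.
    apply (qmk_eq V HV M N HN). lin.
    match goal with |- N ?t => replace t with (vzero : V) by vec end; now apply sub0.
  - intros a A. rewrite (qmk_qrep V M N A), qscal, !qop_qmk, qscal; auto.
    apply (qmk_eq V HV M N HN). lin.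
    match goal with |- N ?t => replace t with (vzero : V) by vec end; now apply sub0.
  - exists K. intro A. apply le_epsilon. intros e He.
    destruct (qnorm_approx A (e / K)) as (x & hx & E & Hx); [now apply Rdiv_lt_0_compat|].
    rewrite E at 1. rewrite qop_qmk; auto.
    eapply Rle_trans; [apply qnorm_le|]. eapply Rle_trans; [apply HK|].
    replace e with (K * (e / K)) by (field; lra). rewrite <- Rmult_plus_distr_l.
    apply Rmult_le_compat_l; lra.
Qed.
End Quotient.

(** * Chains of invariant subspaces *)

Definition invariant_subspace (V : NSpace) (Sg : (V -> V) -> Prop) (L : V -> Prop) : Prop :=
  is_subspace V L /\ forall T, Sg T -> invariant V L T.

Definition rank1_property_semigroup (Rp : forall V : NSpace, (V -> V) -> Prop)
    (V : NSpace) (Sg : (V -> V) -> Prop) : Prop :=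
  (forall T, Sg T -> bounded_op V T /\ Rp V T) /\
  (forall S T, Sg S -> Sg T -> Sg (fun x => S (T x))) /\
  (forall S T, Sg S -> Sg T -> rank_le1 V (commutator S T)).

Lemma rank1_property_semigroup_reducible (Rp : forall V : NSpace, (V -> V) -> Prop)
  (Hb : comm_semigroup_nontriv_inv Rp) (V : NSpace) (HV : IsCBanach V) (Hdim : dim_ge2 V)
  (Sg : (V -> V) -> Prop) (HSg : rank1_property_semigroup Rp V Sg) :
  exists L : V -> Prop, invariant_subspace V Sg L /\
    (exists x, L x /\ x <> vzero) /\ (exists x, ~ L x).
Proof.
  destruct HSg as (HSg & Hmul & Hrank).
  assert (K : exists L : V -> Prop, is_subspace V L /\
    (exists x, L x /\ x <> vzero) /\ (exists x, ~ L x) /\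
    (forall T, Sg T -> invariant V L T)).
  { destruct (classic (exists S T, Sg S /\ Sg T /\ ~ (forall v, S (T v) = T (S v))))
      as [(S & T & HS & HT & Hne)|Hcomm].
    - apply (noncomm_reducible V HV Sg S T); auto.
      + repeat split; try apply bounded_op_lin_op; auto; now apply HSg.
      + intros W HW. now apply HSg.
    - apply (Hb V Sg HV Hdim HSg Hmul). intros S T HS HT.
      apply NNPP. intro Hne. apply Hcomm. now exists S, T. }
  destruct K as (L & ? & ? & ? & ?). now exists L.
Qed.

(** * Gaps between invariant subspaces *)

Section Gap.
Context (V : NSpace) (HV : IsCBanach V) (Sg : (V -> V) -> Prop)
  (Rp : forall V : NSpace, (V -> V) -> Prop)
  (Ha : inherited_by_quotients Rp) (Hb : comm_semigroup_nontriv_inv Rp)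
  (HSg : rank1_property_semigroup Rp V Sg)
  (M N : V -> Prop) (HM : invariant_subspace V Sg M) (HN : invariant_subspace V Sg N)
  (HNM : incl N M).

Local Notation Q := (quotient V M N (proj1 HM)).

Definition quotient_semigroup : (Q -> Q) -> Prop :=
  fun F => exists T (HT : invariant V M T), Sg T /\ F = qop V M N (proj1 HM) T HT.

Lemma quotient_semigroup_rank1 :
  dim_ge2 Q -> rank1_property_semigroup Rp Q quotient_semigroup.
Proof.
  intro Hdim. destruct HSg as (HSgR & Hmul & Hrank).
  destruct HN as [SN IN].
  assert (L : forall T, Sg T -> lin_op V T)
    by (intros T HT; apply bounded_op_lin_op, HSgR, HT).
  assert (B : forall T, Sg T -> bounded_op V T) by (intros T HT; apply HSgR, HT).
  split; [|split].
  - intros F (T & IT & HT & ->). split.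
    + apply qop_bounded; auto.
    + apply (Ha V Sg HV HSgR M N (proj1 HM) SN HNM); auto.
      intros W HW. split; [now apply HM|now apply IN].
  - intros F G (S & IS & HS & ->) (T & IT & HT & ->).
    exists (fun x => S (T x)), (fun x Hx => IS _ (IT x Hx)).
    split; [now apply Hmul|].
    apply functional_extensionality. intro A.
    rewrite (qmk_qrep V M N A), !qop_qmk; auto.
  - intros F G (S & IS & HS & ->) (T & IT & HT & ->).
    destruct (Hrank S T HS HT) as [v Hv].
    (* The vector v need not lie in M. If the commutator takes on M a value c v with c nonzero, then
       v is in M and its class spans the range; otherwise the commutator vanishes on M. *)
    destruct (classic (exists m c, M m /\ c <> C0 /\ commutator S T m = vscal c v))
      as [(m & c & Hm & Hc & E)|Hno].
    + assert (Mv : M v).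
      { replace v with (vscal (Complex.Cinv c) (vscal c v)) by (vcoefs; field; exact Hc).
        rewrite <- E. apply (subZ V M (proj1 HM)). apply (is_subspace_sub V M (proj1 HM) (S (T m)) (T (S m))); auto. }
      exists (qmk M N v Mv). intro A. destruct (Hv (qrep A)) as [a Ea]. exists a.
      rewrite (qmk_qrep V M N A) at 1. unfold commutator at 1.
      rewrite !qop_qmk, qsub, qscal; auto.
      apply qmk_eq; auto. change (N (vsub (commutator S T (qrep A)) (vscal a v))).
      rewrite Ea. replace (vsub (vscal a v) (vscal a v)) with (vzero : V) by vec.
      now apply sub0.
    + exists vzero. intro A. exists C0.
      rewrite (scal0 _ (quotient_banach V HV M N (proj1 HM) SN HNM)).
      destruct (Hv (qrep A)) as [a Ea].
      rewrite (qmk_qrep V M N A) at 1. unfold commutator at 1.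
      rewrite !qop_qmk, qsub; auto.
      apply qmk_eq0; auto. change (N (commutator S T (qrep A))). rewrite Ea.
      destruct (classic (a = C0)) as [->|Hne].
      * rewrite (scal0 V HV). now apply sub0.
      * exfalso. apply Hno. exists (qrep A), a. split; [apply qrep_in|easy].
Qed.

(** L is the preimage in M of a non-trivial invariant subspace of the quotient. *)
Lemma invariant_between : dim_ge2 Q ->
  exists L, invariant_subspace V Sg L /\ incl N L /\ incl L M /\
    (exists x, L x /\ ~ N x) /\ (exists x, M x /\ ~ L x).
Proof.
  intro Hdim.
  pose proof (quotient_banach V HV M N (proj1 HM) (proj1 HN) HNM) as HQ.
  destruct (rank1_property_semigroup_reducible Rp Hb Q HQ Hdim _
    (quotient_semigroup_rank1 Hdim)) as (L & [SL IL] & (A & HA & HA0) & (B & HB)).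
  assert (L1 : forall x hx hx', L (qmk M N x hx) -> L (qmk M N x hx')).
  { intros x hx hx'. now rewrite (proof_irrelevance _ hx hx'). }
  exists (fun x => exists hx : M x, L (qmk M N x hx)).
  split; [split|split; [|split; [|split]]].
  - split.
    + exists (sub0 V M (proj1 HM)). exact (sub0 Q L SL).
    + intros x y [hx Hx] [hy Hy]. exists (subD V M (proj1 HM) x y hx hy).
      rewrite <- qadd; auto; [|apply HN]. now apply (subD Q L SL).
    + intros a x [hx Hx]. exists (subZ V M (proj1 HM) a x hx).
      rewrite <- qscal; auto; [|apply HN]. now apply (subZ Q L SL).
    + intros u l Hu Hl.
      assert (hl : M l).
      { apply (subCl V M (proj1 HM) u); auto. intro n. now destruct (Hu n). }
      exists hl. pose (hu := fun n => let (h, _) := Hu n in h : M (u n)).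
      apply (subCl Q L SL (fun n => qmk M N (u n) (hu n))).
      * intro n. destruct (Hu n) as [h H]. exact (L1 _ h _ H).
      * apply qmk_converges; auto. apply HN.
  - intros T HT x [hx Hx]. exists (proj2 HM T HT x hx).
    rewrite <- (qop_qmk V HV M N (proj1 HM) (proj1 HN) T (proj2 HM T HT)).
    + apply IL; auto. now exists T, (proj2 HM T HT).
    + apply bounded_op_lin_op. now apply HSg.
    + now apply HN.
  - intros x Hx. exists (HNM x Hx).
    replace (qmk M N x (HNM x Hx)) with (@vzero Q); [now apply sub0|].
    symmetry. apply qmk_eq0; auto. apply HN.
  - now intros x [hx _].
  - exists (qrep A). split.
    + exists (qrep_in A). now rewrite <- qmk_qrep.
    + intro H. apply HA0. rewrite (qmk_qrep V M N A). apply qmk_eq0; auto. apply HN.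
  - exists (qrep B). split; [apply qrep_in|]. intros [hx H]. apply HB.
    rewrite (qmk_qrep V M N B). exact (L1 _ _ _ H).
Qed.

(** A vector of L outside N and one of M outside L would have independent classes modulo N. *)
Lemma gap_dim_le1 : ~ dim_ge2 Q -> forall L, is_subspace V L -> incl N L -> incl L M ->
  incl L N \/ incl M L.
Proof.
  intros Hdim L SL HNL HLM.
  destruct (classic (incl L N)) as [?|Hn]; [now left|right].
  apply not_all_ex_not in Hn. destruct Hn as [x Hn].
  apply imply_to_and in Hn. destruct Hn as [Lx Nx].
  intros y My. apply NNPP. intro Ly. apply Hdim.
  exists (qmk M N x (HLM x Lx)), (qmk M N y My). intros a b E.
  rewrite !qscal, qadd in E; auto; try apply HN.
  apply qmk_eq0 in E; auto; try apply HN.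
  assert (Hb0 : b = C0).
  { apply NNPP. intro Hb0. apply Ly.
    replace y with (vscal (Complex.Cinv b)
      (vsub (vadd (vscal a x) (vscal b y)) (vscal a x))) by (vcoefs; field; exact Hb0).
    apply (subZ V L SL), is_subspace_sub; auto. now apply (subZ V L SL). }
  split; [|easy]. apply NNPP. intro Ha0. apply Nx.
  replace x with (vscal (Complex.Cinv a) (vadd (vscal a x) (vscal b y))).
  - apply (subZ V N (proj1 HN)), E.
  - rewrite Hb0. vcoefs; field; exact Ha0.
Qed.
End Gap.

(** * Maximal chains and triangularizability *)

Definition comparable {T : Type} (A B : T -> Prop) : Prop := incl A B \/ incl B A.

(** Zorn's lemma for chains of invariant subspaces. Maximality is only among invariant subspaces
    here; the theorem upgrades it to all closed subspaces. *)
Lemma maximal_invariant_chain (V : NSpace) (Sg : (V -> V) -> Prop) :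
  exists Ch : (V -> Prop) -> Prop,
    (forall M, Ch M -> invariant_subspace V Sg M) /\
    (forall M1 M2, Ch M1 -> Ch M2 -> comparable M1 M2) /\
    (forall M, invariant_subspace V Sg M -> (forall M', Ch M' -> comparable M M') -> Ch M).
Proof.
  destruct (@classical_sets.Zorn_bigcup (V -> Prop) (fun Ch : (V -> Prop) -> Prop =>
    (forall M, Ch M -> invariant_subspace V Sg M) /\
    (forall M1 M2, Ch M1 -> Ch M2 -> comparable M1 M2))) as (Ch & [Hinv Htot] & Hmax).
  - intros F HF Ftot. split.
    + intros M [Ch HCh HM]. exact (proj1 (HF Ch HCh) M HM).
    + intros M1 M2 [Ch1 H1 K1] [Ch2 H2 K2].
      destruct (Ftot Ch1 Ch2 H1 H2) as [S|S].
      * exact (proj2 (HF Ch2 H2) M1 M2 (S _ K1) K2).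
      * exact (proj2 (HF Ch1 H1) M1 M2 K1 (S _ K2)).
  - exists Ch. split; [easy|split; [easy|]]. intros M HM Hcmp.
    apply NNPP. intro HCh.
    apply (Hmax (fun L => Ch L \/ L = M)).
    + split; [now left|intro E; apply HCh, E; now right].
    + split.
      * intros L [HL| ->]; auto.
      * assert (R : comparable M M) by now left.
        intros M1 M2 [H1| ->] [H2| ->]; auto.
        destruct (Hcmp M1 H1); [now right|now left].
Qed.

Theorem mainTheorem3
  (Rp : forall V : NSpace, (V -> V) -> Prop)
  (Ha : inherited_by_quotients Rp)
  (Hb : comm_semigroup_nontriv_inv Rp)
  (X : NSpace) (HX : IsCBanach X) (Hdim : dim_ge2 X)
  (Sg : (X -> X) -> Prop)
  (HSg : forall T, Sg T -> bounded_op X T /\ Rp X T)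
  (Hmul : forall S T, Sg S -> Sg T -> Sg (fun x => S (T x)))
  (Hrank : forall S T, Sg S -> Sg T -> rank_le1 X (commutator S T)) :
  triangularizable X Sg.
Proof.
  destruct (maximal_invariant_chain X Sg) as (Ch & Hinv & Htot & Hmax).
  exists Ch. split; [exact Hinv|split; [exact Htot|]]. intros M SM HM.
  assert (SgR : rank1_property_semigroup Rp X Sg) by now split.
  (* The neighbours of [M] in the chain; [N] is the closed span of the union of the
     members contained in [M]. *)
  set (P := fun x => forall L, (Ch L /\ incl M L) -> L x).
  set (N := fun x => forall L, (is_subspace X L /\ forall M', Ch M' -> incl M' M -> incl M' L)
    -> L x).
  assert (HMP : incl M P) by (intros x Hx L [_ HL]; auto).
  assert (HNM : incl N M) by (intros x Hx; apply Hx; auto).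
  assert (HP : invariant_subspace X Sg P).
  { split.
    - apply is_subspace_meet. intros L [HL _]. now apply Hinv.
    - intros T HT x Hx L HL. apply (Hinv L); [apply HL|easy|now apply Hx]. }
  assert (HNS : is_subspace X N).
  { apply is_subspace_meet. intros L [HL _]. exact HL. }
  assert (HN : invariant_subspace X Sg N).
  (* The preimage of N under T is a closed subspace containing all members of the chain below M,
     hence contains N. *)
  { split; [exact HNS|]. intros T HT x Hx. apply Hx. split.
    - apply is_subspace_preimage; auto. now apply HSg.
    - intros M' HM' HMM' y Hy L [HL HL'].
      apply (HL' M' HM' HMM'). now apply (Hinv M' HM'). }
  assert (Hbelow : forall M', Ch M' -> incl M' M -> incl M' N).
  { intros M' HM' HMM' x Hx L [_ HL]. now apply (HL M'). }
  assert (Habove : forall M', Ch M' -> incl M M' -> incl P M').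
  { intros M' HM' HMM' x Hx. now apply Hx. }
  assert (HNP : incl N P) by (intros x Hx; auto).
  (* Every member of the chain lies below N or above P, so L is comparable with all of them. *)
  assert (Hbetween : forall L, invariant_subspace X Sg L -> incl N L -> incl L P -> Ch L).
  { intros L HL HNL HLP. apply Hmax; [easy|]. intros M' HM'.
    destruct (HM M' HM') as [H|H].
    - left. intros x Hx. apply (Habove M' HM' H). auto.
    - right. intros x Hx. apply HNL, (Hbelow M' HM' H), Hx. }
  assert (Hext : forall A B : X -> Prop, incl A B -> incl B A -> Ch A -> Ch B).
  { intros A B HAB HBA. replace B with A; [easy|].
    apply functional_extensionality. intro x. apply propositional_extensionality.
    split; auto. }
  (* In dimension at least two, an invariant subspace strictly between N and P would join the chain,
     and its comparison with M would push it below N or above P. Otherwise M is N or P. *)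
  destruct (classic (dim_ge2 (quotient X P N (proj1 HP)))) as [Hq|Hq].
  - exfalso.
    destruct (invariant_between X HX Sg Rp Ha Hb SgR P N HP HN HNP Hq)
      as (L & HL & HNL & HLP & (x & Lx & Nx) & (y & Py & Ly)).
    pose proof (Hbetween L HL HNL HLP) as HCh.
    destruct (HM L HCh) as [H|H].
    + apply Ly, (Habove L HCh H), Py.
    + apply Nx, (Hbelow L HCh H), Lx.
  - destruct (gap_dim_le1 X HX Sg P N HP HN Hq M SM HNM HMP) as [H|H].
    + apply (Hext N M HNM H), Hbetween; [easy|now intro|easy].
    + apply (Hext P M H HMP), Hbetween; [easy|easy|now intro].
Qed.
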